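(* Let $(G,v)$ be a based graph and $k$ a positive integer. Then there is an isomorphism of groups \[ \pi_1^{2k}[G,v] \cong \pi_1(\mathcal{N}^k[G],v)\] which is natural with respect to based graph maps.
   Context: A graph $G$ is a pair $(V(G),E(G))$ with $V(G)$ a (possibly infinite) set and $E(G)\subset V(G)^2\setminus\{(v,v)\}$ symmetric. A based graph is a pair $(G,v)$ with $v\in V(G)$. For $v\in V(G)$ let $N_G[v]=\{v\}\cup\{w:(v,w)\in E(G)\}$, and define $N_G^1[v]=N_G[v]$, $N_G^{k+1}[v]=\bigcup_{w\in N_G^k[v]}N_G[w]$. The closed $k$-neighborhood complex $\mathcal{N}^k[G]$ is the simplicial complex on $V(G)$ whose simplices are the finite subsets contained in $N_G^k[w]$ for some $w\in V(G)$; $\pi_1(\mathcal{N}^k[G],v)$ is the fundamental group of its geometric realization based at the vertex $v$. A graph map $f\colon G\to H$ is a function $V(G)\to V(H)$ such that $(x,y)\in E(G)$ implies $f(x)=f(y)$ or $(f(x),f(y))\in E(H)$; it is based, $(G,v)\to(H,w)$, if $f(v)=w$. Let $P_n$ be the path graph on $\{0,1,\dots,n\}$ ($i,j$ adjacent iff $|i-j|=1$). A path of length $n$ in $G$ is a graph map $\gamma\colon P_n\to G$; write $l(\gamma)=n$. Let $\Omega[G,v]$ be the set of paths with $\gamma(0)=\gamma(l(\gamma))=v$. For an integer $m\ge 2$, let $\simeq_m$ be the smallest equivalence relation on $\Omega[G,v]$ containing: (A) $\gamma\simeq_m\gamma'$ whenever $l(\gamma')=l(\gamma)+1$ and there is $x\in\{0,\dots,l(\gamma)\}$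 with $\gamma(i)=\gamma'(i)$ for $i\le x$ and $\gamma(i)=\gamma'(i+1)$ for $i\ge x$; (B)$_m$ $\gamma\simeq_m\gamma'$ whenever $l(\gamma)=l(\gamma')$ and there is $i_0$ with $\gamma(i)=\gamma'(i)$ for all $i\le i_0$ and all $i\ge i_0+m$. The closed $m$-fundamental group $\pi_1^m[G,v]=\Omega[G,v]/\simeq_m$ has group operation induced by concatenation of paths ($(\gamma\cdot\delta)(i)=\gamma(i)$ for $i\le l(\gamma)$, $=\delta(i-l(\gamma))$ for $i\ge l(\gamma)$). (This is the closed $m$-fundamental group of Di–Ivanov–Mukoseev–Zhang, in a combinatorial description.) *)

(* Defs.v *)
From HB Require Import structures.
From Stdlib Require Import Relation_Operators.
From mathcomp Require Import all_boot all_order all_algebra generic_quotient.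
From mathcomp Require Import all_classical all_reals all_analysis.
From mathcomp Require Import homotopy lra zify.

Set Implicit Arguments.
Unset Strict Implicit.
Unset Printing Implicit Defensive.

Import Order.TTheory GRing.Theory Num.Theory.
Import numFieldNormedType.Exports.

Local Open Scope classical_set_scope.
Local Open Scope ring_scope.
Local Open Scope quotient_scope.

Lemma cts_ptws (T U : topologicalType) (I : Type) (f : T -> {ptws I -> U}) :
  (forall i, continuous (fun t => f t i)) -> continuous f.
Proof.
move=> cf t; apply/cvg_sup => i; move: t.
apply/(@continuousP T (initial_topology (fun g : I -> U => g i))) => _ [B oB <-].
by have /continuousP/(_ _ oB) := cf i.
Qed.

Section ContinuityFacts.
Context {T X Y : topologicalType} {R : realType}.

Lemma cts_comp (f : T -> X) (g : X -> Y) :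
  continuous f -> continuous g -> continuous (fun t => g (f t)).
Proof. by move=> cf cg t; apply: (continuous_comp (cf t)); exact: cg. Qed.

Lemma cts_pair (f : T -> X) (g : T -> Y) :
  continuous f -> continuous g -> continuous (fun t => (f t, g t)).
Proof.
move=> cf cg t.
apply: (@cvg_pair _ _ _ (nbhs t) (nbhs (f t)) (nbhs (g t)));
  [exact: cf|exact: cg].
Qed.

Lemma cts_fst : continuous (fun z : X * Y => z.1).
Proof. by move=> z; apply: (@cvg_fst _ _ (nbhs z.1) (nbhs z.2)). Qed.

Lemma cts_snd : continuous (fun z : X * Y => z.2).
Proof. by move=> z; apply: (@cvg_snd _ _ (nbhs z.1) (nbhs z.2)). Qed.

Lemma cts_cst (x : X) : continuous (fun _ : T => x).
Proof. by move=> t; exact: cvg_cst. Qed.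

Lemma cts_add (f g : T -> R) :
  continuous f -> continuous g -> continuous (fun t => f t + g t).
Proof. by move=> cf cg t; apply: (@continuousD R R^o); [exact: cf|exact: cg]. Qed.

Lemma cts_opp (f : T -> R) : continuous f -> continuous (fun t => - f t).
Proof. by move=> cf t; apply: (@continuousN R R^o); exact: cf. Qed.

Lemma cts_mul (f g : T -> R) :
  continuous f -> continuous g -> continuous (fun t => f t * g t).
Proof. by move=> cf cg t; apply: (@continuousM R T); [exact: cf|exact: cg]. Qed.

Lemma cts_min (f g : T -> R) :
  continuous f -> continuous g -> continuous (fun t => Num.min (f t) (g t)).
Proof.
by move=> cf cg t; apply: (@continuous_min R T); [exact: cf|exact: cg].
Qed.

Lemma cts_max (f g : T -> R) :
  continuous f -> continuous g -> continuous (fun t => Num.max (f t) (g t)).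
Proof.
by move=> cf cg t; apply: (@continuous_max R T); [exact: cf|exact: cg].
Qed.

Lemma continuous_pasting (u : T -> R) (c : R) (f g : T -> X) :
  continuous u -> continuous f -> continuous g ->
  (forall t, u t = c -> f t = g t) ->
  continuous (fun t => if u t <= c then f t else g t).
Proof.
move=> uc fc gc fg t W; rewrite /= => nW.
have [utc|utc|utc] := ltgtP (u t) c.
- rewrite (ltW utc) in nW.
  have nu : nbhs t [set t' | u t' < c].
    by apply: (uc t [set z | z < c]); exact: lt_nbhsl.
  apply: filterS2 nu (fc t W nW) => t' /= /ltW -> //.
- rewrite leNgt utc /= in nW.
  have nu : nbhs t [set t' | c < u t'].
    by apply: (uc t [set z | c < z]); exact: lt_nbhsr.
  by apply: filterS2 nu (gc t W nW) => t' /=; rewrite ltNge => /negbTE ->.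
- rewrite utc lexx in nW.
  have nf : nbhs t (f @^-1` W) by exact: fc.
  have ng : nbhs t (g @^-1` W) by apply: gc; rewrite -fg.
  by apply: filterS2 nf ng => t' ? ? /=; case: ifP.
Qed.

End ContinuityFacts.

Definition unit_interval (R : realType) : Type :=
  set_type (`[0, 1]%classic : set R).

HB.instance Definition _ (R : realType) := Topological.on (unit_interval R).

Section UnitInterval.
Variable R : realType.
Local Notation I := (unit_interval R).

Definition ivl (s : I) : R := set_val s.

Lemma ivl_ge0 (s : I) : 0 <= ivl s.
Proof. by have := set_valP s; rewrite /= in_itv /= => /andP[]. Qed.

Lemma ivl_le1 (s : I) : ivl s <= 1.
Proof. by have := set_valP s; rewrite /= in_itv /= => /andP[]. Qed.

Lemma ivl_inj : injective ivl.
Proof. by move=> s t; exact: val_inj. Qed.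

Lemma clamp_subproof (x : R) :
  Num.max 0 (Num.min x 1) \in (`[0, 1]%classic : set R).
Proof.
apply/mem_set; rewrite /= in_itv /= le_max lexx /=.
by rewrite ge_max ler01 /= ge_min lexx orbT.
Qed.

Definition clamp (x : R) : I := 
  exist (fun y : R => y \in `[0, 1]%classic) _ (clamp_subproof x).

Lemma ivl_clamp (x : R) : 0 <= x <= 1 -> ivl (clamp x) = x.
Proof.
by move=> /andP[x0 x1]; rewrite /ivl /= set_valE /= min_l // max_r.
Qed.

Lemma clamp_ivl (s : I) : clamp (ivl s) = s.
Proof. by apply: ivl_inj; rewrite ivl_clamp // ivl_ge0 ivl_le1. Qed.

Lemma clamp_inj01 : clamp 0 != clamp 1.
Proof.
apply/eqP => /(congr1 ivl); rewrite !ivl_clamp ?lexx ?ler01 // => /esym/eqP.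
by rewrite oner_eq0.
Qed.

HB.instance Definition _ := isBiPointed.Build I clamp_inj01.

Lemma ivl0 : ivl zero = 0. Proof. by rewrite ivl_clamp // lexx ler01. Qed.
Lemma ivl1 : ivl one = 1. Proof. by rewrite ivl_clamp // lexx ler01. Qed.

Lemma ivl_continuous : continuous ivl.
Proof. exact: (@initial_continuous _ _ (@set_val R `[0, 1]%classic)). Qed.

Lemma clamp_continuous : continuous clamp.
Proof.
apply: (@continuous_comp_initial _ _ _ (@set_val R `[0, 1]%classic)) => x.
apply: (@continuous_max R R^o (fun=> 0) (fun x => Num.min x 1)).
  exact: cst_continuous.
apply: (@continuous_min R R^o (fun x => x) (fun=> 1)) => //.
exact: cst_continuous.
Qed.

End UnitInterval.

Section UnitIntervalContinuity.
Variables (R : realType) (T : topologicalType).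
Local Notation I := (unit_interval R).

Lemma cts_ivl (f : T -> I) : continuous f -> continuous (fun t => ivl (f t)).
Proof. by move/cts_comp; apply; exact: ivl_continuous. Qed.

Lemma cts_clamp (f : T -> R) :
  continuous f -> continuous (fun t => clamp (f t)).
Proof. by move/cts_comp; apply; exact: clamp_continuous. Qed.

Lemma cts_path (X : topologicalType) (x y : X) (p : {path I from x to y})
  (f : T -> I) : continuous f -> continuous (fun t => p (f t)).
Proof. by move/cts_comp; apply; exact: cts_fun. Qed.

End UnitIntervalContinuity.

Ltac cts := lazymatch goal with
  | |- continuous (fun t => (@?f t, @?g t)) => apply: (@cts_pair _ _ _ f g); cts
  | |- continuous (fun t => @?f t + @?g t) => apply: (@cts_add _ _ f g); cts
  | |- continuous (fun t => - @?f t) => apply: (@cts_opp _ _ f); cts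
  | |- continuous (fun t => @?f t * @?g t) => apply: (@cts_mul _ _ f g); cts
  | |- continuous (fun t => Num.min (@?f t) (@?g t)) =>
      apply: (@cts_min _ _ f g); cts
  | |- continuous (fun t => Num.max (@?f t) (@?g t)) =>
      apply: (@cts_max _ _ f g); cts
  | |- continuous (fun t => ivl (@?f t)) => apply: (@cts_ivl _ _ f); cts
  | |- continuous (fun t => clamp (@?f t)) => apply: (@cts_clamp _ _ f); cts
  | _ => first [ assumption | exact: cts_cst | exact: cts_fst | exact: cts_snd
               | by move=> ?; exact: cvg_id | apply: cts_path; cts ]
  end.

Section LoopHomotopy.
Variables (R : realType) (X : topologicalType) (x : X).
Local Notation I := (unit_interval R).
Local Notation loop := {path I from x to x}.
Implicit Types p q r : loop.

(* homotopy relative to the endpoints; the second coordinate is the time *)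
Definition loop_homotopic p q : Prop :=
  exists H : I * I -> X,
    [/\ continuous H,
        forall s, H (s, zero) = p s,
        forall s, H (s, one) = q s
      & forall t, H (zero, t) = x /\ H (one, t) = x].

Lemma loop_homotopic_refl p : loop_homotopic p p.
Proof.
exists (fun st => p st.1); split=> // [|t]; last by rewrite path_zero path_one.
by cts.
Qed.

Lemma loop_homotopic_sym p q : loop_homotopic p q -> loop_homotopic q p.
Proof.
move=> [H [Hc H0 H1 Hb]].
exists (fun st => H (st.1, clamp (1 - ivl st.2))); split=> [|s|s|t] /=.
- by apply: (cts_comp (g := H)) => //; cts.
- by rewrite ivl0 subr0 H1.
- by rewrite ivl1 subrr H0.
- exact: Hb.
Qed.

Lemma loop_homotopic_trans p q r :
  loop_homotopic p q -> loop_homotopic q r -> loop_homotopic p r.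
Proof.
move=> [H [Hc H0 H1 Hb]] [K [Kc K0 K1 Kb]].
exists (fun st => if ivl st.2 <= 2^-1 then H (st.1, clamp (2 * ivl st.2))
                  else K (st.1, clamp (2 * ivl st.2 - 1))).
split=> [|s|s|t] /=.
- apply: (@continuous_pasting _ _ R (fun st : I * I => ivl st.2)).
  + by cts.
  + by apply: (cts_comp (g := H)) => //; cts.
  + by apply: (cts_comp (g := K)) => //; cts.
  + by move=> [s t] /= ->; rewrite divff ?pnatr_eq0 // subrr H1 K0.
- by rewrite ivl0 invr_ge0 ler0n mulr0 H0.
- rewrite ivl1 mulr1 leNgt invf_lt1 ?ltr1n ?ltr0n //= (_ : 2 - 1 = 1) ?K1 //.
  by lra.
- by case: ifP => _; [exact: Hb|exact: Kb].
Qed.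

Definition loop_homotopicb p q := `[< loop_homotopic p q >].

Lemma loop_homotopicb_equiv : equiv_class_of loop_homotopicb.
Proof.
split=> [p|p q|q p r]; rewrite /loop_homotopicb.
- exact/asboolP/loop_homotopic_refl.
- by apply/asboolP/asboolP; exact: loop_homotopic_sym.
- by move=> /asboolP pq /asboolP qr; exact/asboolP/(loop_homotopic_trans pq qr).
Qed.

Canonical loop_homotopy_equiv := EquivRelPack loop_homotopicb_equiv.

Lemma reparam_homotopic p (phi psi : I -> I) q r :
  continuous phi -> continuous psi -> phi zero = psi zero ->
  phi one = psi one -> (forall s, q s = p (phi s)) ->
  (forall s, r s = p (psi s)) -> loop_homotopic q r.
Proof.
move=> cphi cpsi e0 e1 qE rE.
exists (fun st => p (clamp ((1 - ivl st.2) * ivl (phi st.1) +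
                            ivl st.2 * ivl (psi st.1)))).
have cphi1 : continuous (fun st : I * I => phi st.1).
  by apply: (cts_comp (g := phi)) => //; cts.
have cpsi1 : continuous (fun st : I * I => psi st.1).
  by apply: (cts_comp (g := psi)) => //; cts.
split=> [|s|s|t] /=.
- by cts.
- by rewrite ivl0 subr0 mul1r mul0r addr0 clamp_ivl qE.
- by rewrite ivl1 subrr mul1r mul0r add0r clamp_ivl rE.
- by rewrite -e0 -e1 -!mulrDl subrK !mul1r !clamp_ivl -!qE path_zero path_one.
Qed.

Definition concat_fun p q (s : I) : X :=
  if ivl s <= 2^-1 then p (clamp (2 * ivl s)) else q (clamp (2 * ivl s - 1)).

Lemma concat_continuous p q : continuous (concat_fun p q).
Proof.
apply: (@continuous_pasting _ _ R (@ivl R)); [exact: ivl_continuous|by cts..|].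
by move=> s ->; rewrite divff ?pnatr_eq0 // subrr path_one path_zero.
Qed.

Lemma concat_zero p q : concat_fun p q zero = x.
Proof. by rewrite /concat_fun ivl0 invr_ge0 ler0n mulr0 path_zero. Qed.

Lemma concat_one p q : concat_fun p q one = x.
Proof.
rewrite /concat_fun ivl1 leNgt invf_lt1 ?ltr1n ?ltr0n //= (_ : 2 * 1 - 1 = 1).
  by rewrite path_one.
by lra.
Qed.

Definition concat p q : loop :=
  mk_path (@concat_continuous p q) (concat_zero p q) (concat_one p q).

Definition rev_fun p (s : I) : X := p (clamp (1 - ivl s)).

Lemma rev_continuous p : continuous (rev_fun p).
Proof. by rewrite /rev_fun; cts. Qed.

Lemma rev_zero p : rev_fun p zero = x.
Proof. by rewrite /rev_fun ivl0 subr0 path_one. Qed.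

Lemma rev_one p : rev_fun p one = x.
Proof. by rewrite /rev_fun ivl1 subrr path_zero. Qed.

Definition rev_loop p : loop :=
  mk_path (@rev_continuous p) (rev_zero p) (rev_one p).

Definition cst_loop : loop := cst x.

Lemma concat_homotopic p p' q q' :
  loop_homotopic p p' -> loop_homotopic q q' ->
  loop_homotopic (concat p q) (concat p' q').
Proof.
move=> [H [Hc H0 H1 Hb]] [K [Kc K0 K1 Kb]].
exists (fun st => if ivl st.1 <= 2^-1 then H (clamp (2 * ivl st.1), st.2)
                  else K (clamp (2 * ivl st.1 - 1), st.2)).
split=> [|s|s|t] /=.
- apply: (@continuous_pasting _ _ R (fun st : I * I => ivl st.1)).
  + by cts.
  + by apply: (cts_comp (g := H)) => //; cts.
  + by apply: (cts_comp (g := K)) => //; cts.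
  + move=> [s t] /= ->; rewrite divff ?pnatr_eq0 // subrr.
    by rewrite (Kb t).1 (Hb t).2.
- by rewrite H0 K0.
- by rewrite H1 K1.
- rewrite ivl0 ivl1 invr_ge0 ler0n mulr0 (Hb t).1; split=> //.
  rewrite leNgt invf_lt1 ?ltr1n ?ltr0n //= (_ : 2 * 1 - 1 = 1) ?(Kb t).2 //.
  by lra.
Qed.

Lemma rev_homotopic p q :
  loop_homotopic p q -> loop_homotopic (rev_loop p) (rev_loop q).
Proof.
move=> [H [Hc H0 H1 Hb]].
exists (fun st => H (clamp (1 - ivl st.1), st.2)); split=> [|s|s|t] /=.
- by apply: (cts_comp (g := H)) => //; cts.
- by rewrite H0.
- by rewrite H1.
- by rewrite ivl0 ivl1 subr0 subrr (Hb t).1 (Hb t).2.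
Qed.

Let geF (a b : R) : b < a -> (a <= b) = false.
Proof. exact: lt_geF. Qed.

Lemma concatA p q r :
  loop_homotopic (concat p (concat q r)) (concat (concat p q) r).
Proof.
apply: (@reparam_homotopic (concat p (concat q r)) (fun s => s)
  (fun s => clamp (Num.min (2 * ivl s)
     (Num.min (ivl s + 4^-1) (2^-1 * (ivl s + 1)))))) => //; try by cts.
- rewrite ivl0 min_l ?mulr0 // le_min; apply/andP; split; lra.
- rewrite ivl1 (_ : Num.min _ _ = 1) // min_r; first by rewrite min_r; lra.
  by rewrite ge_min; apply/orP; right; lra.
move=> s; rewrite /= /mk_path /= /concat_fun.
have := ivl_ge0 s; have := ivl_le1 s; set t := ivl s => t1 t0.
have [t2|t2] := leP t 2^-1.
- have [t4|t4] := leP t 4^-1.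
  + have -> : Num.min (2 * t) (Num.min (t + 4^-1) (2^-1 * (t + 1))) = 2 * t.
      by rewrite min_l // le_min; apply/andP; split; lra.
    rewrite !ivl_clamp; [|lra..].
    rewrite /= /mk_path /= /concat_fun ivl_clamp; last lra.
    by rewrite !ifT //; lra.
  + have -> : Num.min (2 * t) (Num.min (t + 4^-1) (2^-1 * (t + 1))) = t + 4^-1.
      by rewrite (min_l (x := t + _)) ?min_r; lra.
    rewrite /= /mk_path /= /concat_fun !ivl_clamp; [|lra..].
    rewrite ifF; last (by apply: geF; lra).
    rewrite ifF; last (by apply: geF; lra).
    rewrite ifT; last lra.
    by congr (q (clamp _)); lra.
- have -> : Num.min (2 * t) (Num.min (t + 4^-1) (2^-1 * (t + 1)))
            = 2^-1 * (t + 1).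
    by rewrite (min_r (x := t + _)) ?min_r; lra.
  rewrite /= /mk_path /= /concat_fun !ivl_clamp; [|lra..].
  rewrite ifF; last (by apply: geF; lra).
  rewrite ifF; last (by apply: geF; lra).
  by congr (r (clamp _)); lra.
Qed.

Lemma clamp_le0 (u : R) : u <= 0 -> clamp u = zero.
Proof.
by move=> u0; apply: ivl_inj; rewrite ivl0 /ivl /= set_valE /= max_l // ge_min u0.
Qed.

Lemma clamp_ge1 (u : R) : 1 <= u -> clamp u = one.
Proof.
move=> u1; apply: ivl_inj; rewrite ivl1 /ivl /= set_valE /= min_r // max_r //.
Qed.

Lemma concat1p p : loop_homotopic (concat cst_loop p) p.
Proof.
apply: (@reparam_homotopic p (fun s => clamp (2 * ivl s - 1)) (fun s => s)) => //;
  try by cts.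
- by rewrite ivl0 clamp_le0 //; lra.
- by rewrite ivl1 clamp_ge1 //; lra.
move=> s; rewrite /= /mk_path /= /concat_fun; case: ifP => // s2.
by rewrite [in RHS]clamp_le0 ?path_zero //; lra.
Qed.

Lemma concatp1 p : loop_homotopic (concat p cst_loop) p.
Proof.
apply: (@reparam_homotopic p (fun s => clamp (2 * ivl s)) (fun s => s)) => //;
  try by cts.
- by rewrite ivl0 mulr0.
- by rewrite ivl1 clamp_ge1 //; lra.
move=> s; rewrite /= /mk_path /= /concat_fun; have [//|s2] := leP (ivl s) 2^-1.
by rewrite [in RHS]clamp_ge1 ?path_one //; lra.
Qed.

Lemma concatVp p : loop_homotopic (concat (rev_loop p) p) cst_loop.
Proof.
apply: (@reparam_homotopic p
  (fun s => clamp (Num.max (1 - 2 * ivl s) (2 * ivl s - 1))) (fun=> one));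
  try by cts.
- by rewrite ivl0 clamp_ge1 // le_max; apply/orP; left; lra.
- by rewrite ivl1 clamp_ge1 // le_max; apply/orP; right; lra.
- move=> s; rewrite /= /mk_path /= /concat_fun /= /mk_path /= /rev_fun.
  have := ivl_ge0 s; have := ivl_le1 s; set t := ivl s => t1 t0.
  have [t2|t2] := leP t 2^-1.
  + by rewrite ivl_clamp ?max_l //; lra.
  + by rewrite max_r //; lra.
- by move=> s; rewrite path_one.
Qed.

Lemma concatpV p : loop_homotopic (concat p (rev_loop p)) cst_loop.
Proof.
apply: (@reparam_homotopic p
  (fun s => clamp (Num.min (2 * ivl s) (2 - 2 * ivl s))) (fun=> zero));
  try by cts.
- by rewrite ivl0 clamp_le0 // ge_min; apply/orP; left; lra.
- by rewrite ivl1 clamp_le0 // ge_min; apply/orP; right; lra.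
- move=> s; rewrite /= /mk_path /= /concat_fun /= /mk_path /= /rev_fun.
  have := ivl_ge0 s; have := ivl_le1 s; set t := ivl s => t1 t0.
  have [t2|t2] := leP t 2^-1.
  + by rewrite min_l //; lra.
  + rewrite ivl_clamp ?min_r; [|lra..].
    by congr (p (clamp _)); lra.
- by move=> s; rewrite path_zero.
Qed.

Definition pi1 : Type := {eq_quot loop_homotopy_equiv}.

HB.instance Definition _ := EqQuotient.on pi1.
HB.instance Definition _ := Choice.on pi1.

Definition loop_class p : pi1 := \pi_pi1 p.

Lemma loop_classP p q : loop_class p = loop_class q <-> loop_homotopic p q.
Proof. by split=> [/eqmodP/asboolP|pq]; last exact/eqmodP/asboolP. Qed.

Lemma loop_class_surj (a : pi1) : exists p, a = loop_class p.
Proof. by exists (repr a); rewrite /loop_class reprK. Qed.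

Definition pi1_mul (a b : pi1) : pi1 := loop_class (concat (repr a) (repr b)).
Definition pi1_inv (a : pi1) : pi1 := loop_class (rev_loop (repr a)).
Definition pi1_one : pi1 := loop_class cst_loop.

Lemma repr_loop_class p : loop_homotopic (repr (loop_class p)) p.
Proof. by apply/loop_classP; rewrite {1}/loop_class reprK. Qed.

Lemma pi1_mulE p q :
  pi1_mul (loop_class p) (loop_class q) = loop_class (concat p q).
Proof. by apply/loop_classP; apply: concat_homotopic; exact: repr_loop_class. Qed.

Lemma pi1_invE p : pi1_inv (loop_class p) = loop_class (rev_loop p).
Proof. by apply/loop_classP; apply: rev_homotopic; exact: repr_loop_class. Qed.

Lemma pi1_mulA : associative pi1_mul.
Proof.
move=> a b c; have [p ->] := loop_class_surj a.
have [q ->] := loop_class_surj b; have [r ->] := loop_class_surj c.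
by rewrite !pi1_mulE; apply/loop_classP; exact: concatA.
Qed.

Lemma pi1_mul1 : left_id pi1_one pi1_mul.
Proof.
move=> a; have [p ->] := loop_class_surj a.
by rewrite pi1_mulE; apply/loop_classP; exact: concat1p.
Qed.

Lemma pi1_mulr1 : right_id pi1_one pi1_mul.
Proof.
move=> a; have [p ->] := loop_class_surj a.
by rewrite pi1_mulE; apply/loop_classP; exact: concatp1.
Qed.

Lemma pi1_mulV : left_inverse pi1_one pi1_inv pi1_mul.
Proof.
move=> a; have [p ->] := loop_class_surj a.
by rewrite pi1_invE pi1_mulE; apply/loop_classP; exact: concatVp.
Qed.

Lemma pi1_mulrV : right_inverse pi1_one pi1_inv pi1_mul.
Proof.
move=> a; have [p ->] := loop_class_surj a.
by rewrite pi1_invE pi1_mulE; apply/loop_classP; exact: concatpV.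
Qed.

HB.instance Definition _ :=
  isGroup.Build pi1 pi1_mulA pi1_mul1 pi1_mulr1 pi1_mulV pi1_mulrV.

End LoopHomotopy.

Section InducedMap.
Variables (R : realType) (X Y : topologicalType) (x : X) (y : Y).
Variables (f : X -> Y) (fc : continuous f) (fxy : f x = y).
Local Notation I := (unit_interval R).

Lemma push_continuous (p : {path I from x to x}) : continuous (f \o p).
Proof. by apply: cts_comp => //; exact: cts_fun. Qed.

Lemma push_zero (p : {path I from x to x}) : (f \o p) zero = y.
Proof. by rewrite /= path_zero. Qed.

Lemma push_one (p : {path I from x to x}) : (f \o p) one = y.
Proof. by rewrite /= path_one. Qed.

Definition push_loop (p : {path I from x to x}) : {path I from y to y} :=
  mk_path (@push_continuous p) (push_zero p) (push_one p).

Definition pi1_map (a : pi1 R x) : pi1 R y := loop_class (push_loop (repr a)).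

Lemma pi1_mapE p : pi1_map (loop_class p) = loop_class (push_loop p).
Proof.
apply/loop_classP; have [H [Hc H0 H1 Hb]] := repr_loop_class p.
exists (fun st => f (H st)); split=> [|s|s|t].
- exact: cts_comp.
- by rewrite H0.
- by rewrite H1.
- by rewrite (Hb t).1 (Hb t).2.
Qed.

End InducedMap.

(* The empty set may be a simplex; it carries no point of the realization. *)
Record simplicial_complex := SimplicialComplex {
  cvertex :> choiceType;
  simplex : set (set cvertex);
  simplex_finite : forall s, simplex s -> finite_set s;
  simplex_sub : forall s t, t `<=` s -> simplex s -> simplex t;
  simplex1 : forall v, simplex [set v]
}.

Section Realization.
Variables (R : realType) (K : simplicial_complex).

(* barycentric coordinates *)
Record realization := Realization {
  coord :> K -> R;
  coord_ge0 : forall v, 0 <= coord v;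
  coord_simplex : simplex [set v | coord v != 0];
  coord_sum1 : \sum_(v \in [set: K]) coord v = 1
}.

Lemma realization_eqP (a b : realization) : coord a =1 coord b -> a = b.
Proof.
case: a b => [a a0 as_ a1] [b b0 bs b1] /= /funext ab.
by move: a0 as_ a1 b0 bs b1; rewrite ab => *; congr Realization;
  exact: Prop_irrelevance.
Qed.

HB.instance Definition _ := gen_eqMixin realization.
HB.instance Definition _ := gen_choiceMixin realization.

Definition coord_topology : Type :=
  initial_topology (coord : realization -> {ptws K -> R}).

HB.instance Definition _ := Topological.on coord_topology.

(* the closed cell spanned by s *)
Definition cell (s : set K) : set coord_topology :=
  [set a : realization | [set v | a v != 0] `<=` s].

(* The coherent topology: on a cell the coordinate topology is the Euclidean
   one, and U is open iff its trace on every cell is. For complexes that are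
   not locally finite this is finer than coord_topology. *)
Definition realization_open (U : set realization) : Prop :=
  forall s, simplex s -> open (U : set (subspace (cell s))).

Lemma realization_openT : realization_open setT.
Proof. by move=> s _; exact: openT. Qed.

Lemma realization_openI : setI_closed realization_open.
Proof. by move=> U V oU oV s Ks; apply: openI; [exact: oU|exact: oV]. Qed.

Lemma realization_open_bigcup (I : Type) (U : I -> set realization) :
  (forall i, realization_open (U i)) -> realization_open (\bigcup_i U i).
Proof. by move=> oU s Ks; apply: bigcup_open => i _; exact: oU. Qed.

HB.instance Definition _ := isOpenTopological.Build realization
  realization_openT realization_openI realization_open_bigcup.

Lemma openE_realization (U : set realization) : open U <-> realization_open U.
Proof. by []. Qed.

Definition vertex_coord (v w : K) : R := (w == v)%:R.

Lemma vertex_coord_support v : [set w | vertex_coord v w != 0] = [set v].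
Proof.
apply/seteqP; split=> w /=; rewrite /vertex_coord; last first.
  by move->; rewrite eqxx oner_eq0.
by case: (eqVneq w v) => // _ /eqP.
Qed.

Lemma vertex_coord_ge0 v w : 0 <= vertex_coord v w.
Proof. exact: ler0n. Qed.

Lemma vertex_coord_simplex v : simplex [set w | vertex_coord v w != 0].
Proof. by rewrite vertex_coord_support; exact: simplex1. Qed.

Lemma vertex_coord_sum1 v : \sum_(w \in [set: K]) vertex_coord v w = 1.
Proof.
rewrite -(fsbig_widen [set v]) ?fsbig_set1 /vertex_coord ?eqxx //.
by move=> w /= [_ /eqP /negbTE ->].
Qed.

Definition vertex_point (v : K) : realization :=
  Realization (vertex_coord_ge0 v) (vertex_coord_simplex v)
    (vertex_coord_sum1 v).

End Realization.

Arguments simplex : clear implicits.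

Record simplicial_map (K L : simplicial_complex) := SimplicialMap {
  smap :> K -> L;
  smapP : forall s, simplex K s -> simplex L (smap @` s)
}.

Section RealizationMap.
Variables (R : realType) (K L : simplicial_complex) (f : simplicial_map K L).
Local Notation rK := (realization R K).

Definition push_coord (a : rK) (w : L) : R :=
  \sum_(v \in f @^-1` [set w]) a v.

Lemma fin_support (a : rK) : finite_set [set v | a v != 0].
Proof. exact: simplex_finite (coord_simplex a). Qed.

Lemma push_coord_ge0 a w : 0 <= push_coord a w.
Proof. by apply: fsumr_ge0 => v _; exact: coord_ge0. Qed.

Lemma push_coordE (a : rK) (s : set K) w : finite_set s ->
  [set v | a v != 0] `<=` s ->
  push_coord a w = \sum_(v \in s `&` f @^-1` [set w]) a v.
Proof.
move=> fs as_; rewrite /push_coord; apply/esym/fsbig_widen; first by move=> v [].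
move=> v /= [fv] nv; apply/eqP; apply: contrapT => /negP av.
by apply: nv; split=> //; exact: as_.
Qed.

Lemma push_coord_support (a : rK) :
  [set w | push_coord a w != 0] `<=` f @` [set v | a v != 0].
Proof.
move=> w /= aw; apply: contrapT => nw; move/negP: aw; apply.
rewrite /push_coord fsbig1 // => v /= fv.
by apply/eqP; apply: contrapT => /negP av; apply: nw; exists v.
Qed.

Lemma push_coord_simplex a : simplex L [set w | push_coord a w != 0].
Proof.
apply: simplex_sub (@push_coord_support a) _.
by apply: smapP; exact: coord_simplex.
Qed.

Lemma push_coord_sum1 a : \sum_(w \in [set: L]) push_coord a w = 1.
Proof.
pose s := [set v | a v != 0]; have fs : finite_set s := fin_support a.
have ft : finite_set (f @` s) by exact: finite_image.
transitivity (\sum_(w \in f @` s) \sum_(v \in s) if f v == w then a v else 0).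
  rewrite -(fsbig_widen (f @` s)) //; last first.
    move=> w /= [_ nw]; apply/eqP; apply: contrapT => /negP aw.
    by apply: nw; exact: (push_coord_support aw).
  apply: eq_fsbigr => w _; rewrite (@push_coordE _ s) //.
  rewrite -(fsbig_widen (s `&` f @^-1` [set w]) s); last 2 first.
  - by move=> v [].
  - move=> v /= [sv nv]; case: eqVneq => // fv; exfalso; exact: nv.
  by apply: eq_fsbigr => v; rewrite inE => -[_ /= ->]; rewrite eqxx.
rewrite exchange_fsbig //.
transitivity (\sum_(v \in s) a v); last first.
  rewrite -(coord_sum1 a); apply: fsbig_widen => // v /= [_ /negP].
  by rewrite negbK => /eqP.
apply: eq_fsbigr => v; rewrite inE => sv.
rewrite -(fsbig_widen [set f v]) ?fsbig_set1 ?eqxx //.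
  by move=> w ->; exists v.
by move=> w /= [_ /eqP]; rewrite eq_sym => /negbTE ->.
Qed.

Definition realization_map (a : rK) : realization R L :=
  Realization (push_coord_ge0 a) (push_coord_simplex a) (push_coord_sum1 a).

Lemma realization_map_vertex v :
  realization_map (vertex_point R v) = vertex_point R (f v).
Proof.
apply: realization_eqP => w /=; rewrite (@push_coordE _ [set v]) //; last first.
  by rewrite /= vertex_coord_support.
rewrite /= /vertex_coord; case: (eqVneq w (f v)) => [->|wfv].
  rewrite (_ : _ `&` _ = [set v]) ?fsbig_set1 ?eqxx //.
  by apply/seteqP; split=> [u []|u ->] //.
rewrite (_ : _ `&` _ = set0) ?fsbig_set0 //.
by apply/seteqP; split=> [u /= [->] fv|//]; rewrite fv eqxx in wfv.
Qed.

Lemma realization_map_continuous : continuous realization_map.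
Proof.
apply/continuousP => U /openE_realization oU.
apply/openE_realization => s Ks; apply/open_subspaceP.
have /open_subspaceP[V [A oA VA] VU] := oU _ (smapP f Ks).
pose F (b : {ptws K -> R}) : {ptws L -> R} :=
  fun w => \sum_(v \in s `&` f @^-1` [set w]) b v.
have FE (a : rK) : [set v | a v != 0] `<=` s -> F a = realization_map a.
  move=> as_; apply/funext => w /=; rewrite (@push_coordE _ s) //.
  exact: simplex_finite Ks.
have Fc : continuous F.
  apply: cts_ptws => w.
  have fsw : finite_set (s `&` f @^-1` [set w]).
    by apply: finite_setIl; exact: simplex_finite Ks.
  rewrite (_ : (fun b => F b w) = fun b : {ptws K -> R} =>
      \sum_(v <- finmap.enum_fset (fset_set (s `&` f @^-1` [set w]))) b v);
    last first.
    by apply/funext => b; rewrite /F fsbig_finite.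
  apply: (@continuous_big R K +%R 0 predT) => [|v _].
    by move=> z; apply: (@add_continuous R).
  exact: (@proj_continuous K (fun=> R) v).
exists ((@coord R K : rK -> {ptws K -> R}) @^-1` (F @^-1` A)).
  by exists (F @^-1` A) => //; move/continuousP: Fc; exact.
have cellf (a : rK) : cell s a -> cell (f @` s) (realization_map a).
  move=> sa w aw; have [v av <-] := push_coord_support aw.
  by exists v => //; exact: sa.
apply/seteqP; split=> a /= [Ua sa]; split=> //.
  have : (V `&` cell (f @` s)) (realization_map a).
    split; last exact: cellf.
    by rewrite -VA; move: Ua; rewrite (FE _ sa).
  by rewrite VU => -[].
have : (U `&` cell (f @` s)) (realization_map a) by split=> //; exact: cellf.
rewrite -VU -VA => -[Aa _].
by rewrite (FE _ sa).
Qed.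

End RealizationMap.

Record graph := Graph {
  gvertex :> choiceType;
  adj : gvertex -> gvertex -> Prop;
  adj_sym : forall v w, adj v w -> adj w v;
  adj_irr : forall v, ~ adj v v
}.

Record graph_map (G H : graph) := GraphMap {
  gmap :> G -> H;
  gmapP : forall v w, adj v w -> gmap v = gmap w \/ adj (gmap v) (gmap w)
}.

Record based_graph := BasedGraph { bgraph :> graph; base : bgraph }.

Record based_map (X Y : based_graph) := BasedMap {
  bmap :> graph_map X Y;
  bmapP : bmap (base X) = base Y
}.

Definition cnbhd (G : graph) (v : G) : set G := [set w | w = v \/ adj v w].

(* knbhd 0 v = {v}, so that knbhd 1 v = cnbhd v *)
Fixpoint knbhd (G : graph) (k : nat) (v : G) : set G :=
  if k is k'.+1 then \bigcup_(w in knbhd k' v) cnbhd w else [set v].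

Lemma knbhd_refl (G : graph) k (v : G) : knbhd k v v.
Proof. by elim: k => //= k IHk; exists v => //; left. Qed.

Lemma knbhd1 (G : graph) (v : G) : knbhd 1 v = cnbhd v.
Proof. by rewrite /= bigcup_set1. Qed.

Lemma knbhd_map (G H : graph) (f : graph_map G H) k (v w : G) :
  knbhd k v w -> knbhd k (f v) (f w).
Proof.
elim: k w => [|k IHk] w /= => [->//|[u vu uw]].
exists (f u); first exact: IHk.
by case: uw => [->|/(gmapP f)[->|]]; [left|left|right].
Qed.

Section NeighborhoodComplex.
Variables (k : nat) (G : graph).

Definition ncomplex_simplex (s : set G) : Prop :=
  finite_set s /\ exists w : G, s `<=` knbhd k w.

Lemma ncomplex_finite s : ncomplex_simplex s -> finite_set s.
Proof. by case. Qed.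

Lemma ncomplex_sub s t : t `<=` s -> ncomplex_simplex s -> ncomplex_simplex t.
Proof.
move=> ts [fs [w sw]]; split; first exact: sub_finite_set fs.
by exists w; exact: subset_trans sw.
Qed.

Lemma ncomplex1 v : ncomplex_simplex [set v].
Proof. by split=> //; exists v => _ ->; exact: knbhd_refl. Qed.

Definition ncomplex : simplicial_complex :=
  SimplicialComplex ncomplex_finite ncomplex_sub ncomplex1.

End NeighborhoodComplex.

Section NeighborhoodComplexMap.
Variables (k : nat) (G H : graph) (f : graph_map G H).

Lemma ncomplex_mapP (s : set (ncomplex k G)) :
  simplex (ncomplex k G) s -> simplex (ncomplex k H) (f @` s).
Proof.
move=> [fs [w sw]]; split; first exact: finite_image.
by exists (f w) => _ [v sv <-]; apply: knbhd_map; exact: sw.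
Qed.

Definition ncomplex_map : simplicial_map (ncomplex k G) (ncomplex k H) :=
  SimplicialMap ncomplex_mapP.

End NeighborhoodComplexMap.

Section Pi1Neighborhood.
Variables (R : realType) (k : nat).

Definition ncomplex_base (X : based_graph) : realization R (ncomplex k X) :=
  vertex_point R (base X : ncomplex k X).

Lemma ncomplex_map_base (X Y : based_graph) (f : based_map X Y) :
  realization_map (ncomplex_map k f) (ncomplex_base X) = ncomplex_base Y.
Proof. by rewrite realization_map_vertex /= bmapP. Qed.

Definition pi1_ncomplex_map (X Y : based_graph) (f : based_map X Y) :
    pi1 R (ncomplex_base X) -> pi1 R (ncomplex_base Y) :=
  pi1_map (@realization_map_continuous R _ _ (ncomplex_map k f))
    (ncomplex_map_base f).

End Pi1Neighborhood.

Local Open Scope nat_scope.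

Section PathGraph.
Variable n : nat.

Definition path_adj (i j : 'I_n.+1) : Prop := i.+1 = j \/ j.+1 = i :> nat.

Lemma path_adj_sym i j : path_adj i j -> path_adj j i.
Proof. by case; [right|left]. Qed.

Lemma path_adj_irr i : ~ path_adj i i.
Proof. by rewrite /path_adj; lia. Qed.

Definition path_graph : graph := Graph path_adj_sym path_adj_irr.

End PathGraph.

Record gpath (G : graph) := GPath {
  plen : nat;
  pmap : graph_map (path_graph plen) G
}.

(* the vertex visited at time i, meaningful for i <= plen p *)
Definition visit (G : graph) (p : gpath G) (i : nat) : G := pmap p (inord i).

Record gloop (X : based_graph) := GLoop {
  gloop_path :> gpath X;
  gloop_start : pmap gloop_path ord0 = base X;
  gloop_end : pmap gloop_path ord_max = base X
}.

HB.instance Definition _ X := gen_eqMixin (gloop X).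
HB.instance Definition _ X := gen_choiceMixin (gloop X).

Section Loops.
Variable X : based_graph.
Implicit Types p q r : gloop X.

Lemma visit0 p : visit p 0 = base X.
Proof. by rewrite -(gloop_start p); congr (pmap p _); apply/val_inj/inordK. Qed.

Lemma visit_end p : visit p (plen p) = base X.
Proof. by rewrite -(gloop_end p); congr (pmap p _); apply/val_inj/inordK. Qed.

(* inord i is 0 when i is out of bounds *)
Lemma visit_out p i : plen p < i -> visit p i = base X.
Proof.
move=> pi; rewrite -(visit0 p); congr (pmap p _); apply/val_inj => /=.
by rewrite [RHS]inordK // /inord val_insubd ltnS leqNgt pi.
Qed.

Lemma visit_step p i : visit p i = visit p i.+1 \/ adj (visit p i) (visit p i.+1).
Proof.
have [ip|ip] := ltnP i (plen p).
  by apply: (gmapP (pmap p)); left; rewrite !inordK // ltnS; lia.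
left; rewrite (@visit_out p i.+1) ?ltnS //.
have [->|ni] := eqVneq i (plen p); first by rewrite visit_end.
by rewrite visit_out //; lia.
Qed.

Lemma gloop_eqP p q : plen p = plen q ->
  (forall i, i <= plen p -> visit p i = visit q i) -> p = q.
Proof.
case: p q => [[n [f fP]] p0 p1] [[n' [g gP]] q0 q1]; rewrite /visit /= => nn.
subst n' => fg; have E : f = g.
  apply/funext => i; have /= := fg i; rewrite -ltnS ltn_ord inord_val.
  by apply.
subst g; rewrite (Prop_irrelevance gP fP) in q0 q1 *.
by congr GLoop; exact: Prop_irrelevance.
Qed.

Section MkLoop.
Variables (n : nat) (f : nat -> X).
Hypothesis fP : forall i, i < n -> f i = f i.+1 \/ adj (f i) (f i.+1).
Hypotheses (f0 : f 0 = base X) (fn : f n = base X).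

Lemma mk_gmapP (i j : path_graph n) : adj i j -> f i = f j \/ adj (f i) (f j).
Proof.
have := ltn_ord i; have := ltn_ord j; rewrite !ltnS => jn in_ /= [E|E].
  by rewrite -E; apply: fP; lia.
rewrite -E; case: (@fP j) => [|->|/adj_sym]; [by lia|by left|by right].
Qed.

Definition mk_gloop : gloop X :=
  @GLoop X (@GPath X n (GraphMap mk_gmapP)) f0 fn.

Lemma visit_mk i : i <= n -> visit mk_gloop i = f i.
Proof. by move=> i_n; rewrite /visit /= inordK. Qed.

End MkLoop.

(* q is p pausing for one unit of time at time x *)
Definition stretch p q : Prop :=
  plen q = (plen p).+1 /\
  exists2 x, x <= plen p &
    (forall i, i <= x -> visit p i = visit q i) /\
    (forall i, x <= i <= plen p -> visit p i = visit q i.+1).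

(* p and q may differ only at times strictly between i0 and i0 + m *)
Definition jump (m : nat) p q : Prop :=
  plen p = plen q /\
  exists i0, forall i, i <= plen p -> i <= i0 \/ i0 + m <= i ->
    visit p i = visit q i.

Definition gloop_equiv (m : nat) : gloop X -> gloop X -> Prop :=
  clos_refl_sym_trans _ (fun p q => stretch p q \/ jump m p q).

Definition gcat_fun p q (i : nat) : X :=
  if i <= plen p then visit p i else visit q (i - plen p).

Lemma gcat_funr p q i : plen p <= i -> gcat_fun p q i = visit q (i - plen p).
Proof.
rewrite leq_eqVlt /gcat_fun => /predU1P[<-|]; last by rewrite ltnNge => /negbTE ->.
by rewrite leqnn subnn visit_end visit0.
Qed.

Lemma gcat_step p q i : i < plen p + plen q ->
  gcat_fun p q i = gcat_fun p q i.+1 \/ adj (gcat_fun p q i) (gcat_fun p q i.+1).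
Proof.
move=> _; have [ip|pi] := ltnP i (plen p).
  by rewrite /gcat_fun (ltnW ip) ip; exact: visit_step.
rewrite !gcat_funr ?subSn //; [exact: visit_step|exact: leqW].
Qed.

Lemma gcat_start p q : gcat_fun p q 0 = base X.
Proof. by rewrite /gcat_fun leq0n visit0. Qed.

Lemma gcat_end p q : gcat_fun p q (plen p + plen q) = base X.
Proof. by rewrite gcat_funr ?leq_addr // addKn visit_end. Qed.

Definition gcat p q : gloop X :=
  mk_gloop (@gcat_step p q) (gcat_start p q) (gcat_end p q).

Lemma grev_step p i : i < plen p ->
  visit p (plen p - i) = visit p (plen p - i.+1) \/
  adj (visit p (plen p - i)) (visit p (plen p - i.+1)).
Proof.
move=> ip; rewrite (_ : plen p - i = (plen p - i.+1).+1); last by lia.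
by case: (visit_step p (plen p - i.+1)) => [->|/adj_sym]; [left|right].
Qed.

Lemma grev_start p : visit p (plen p - 0) = base X.
Proof. by rewrite subn0 visit_end. Qed.

Lemma grev_end p : visit p (plen p - plen p) = base X.
Proof. by rewrite subnn visit0. Qed.

Definition grev p : gloop X :=
  mk_gloop (@grev_step p) (grev_start p) (grev_end p).

Definition gtriv : gloop X :=
  @mk_gloop 0 (fun=> base X) (fun _ _ => or_introl erefl) erefl erefl.

Lemma plen_cat p q : plen (gcat p q) = plen p + plen q. Proof. by []. Qed.

Lemma plen_triv : plen gtriv = 0. Proof. by []. Qed.

Lemma plen_rev p : plen (grev p) = plen p. Proof. by []. Qed.

Lemma visit_cat p q i : i <= plen p + plen q ->
  visit (gcat p q) i = gcat_fun p q i.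
Proof. exact: visit_mk. Qed.

Lemma visit_rev p i : i <= plen p -> visit (grev p) i = visit p (plen p - i).
Proof. exact: visit_mk. Qed.

Lemma gcatA p q r : gcat p (gcat q r) = gcat (gcat p q) r.
Proof.
apply: gloop_eqP => [|i]; rewrite !plen_cat; first by rewrite addnA.
move=> ile; rewrite !visit_cat ?plen_cat; [|by lia..].
have [ip|pi] := leqP i (plen p).
  rewrite [RHS]/gcat_fun plen_cat ifT; last by lia.
  rewrite visit_cat; last by lia.
  by rewrite /gcat_fun ip.
rewrite (@gcat_funr p) ?(ltnW pi) // visit_cat; last by lia.
have [iq|qi] := leqP i (plen p + plen q).
  rewrite [RHS]/gcat_fun plen_cat iq visit_cat // (@gcat_funr p q) ?(ltnW pi) //.
  by rewrite /gcat_fun ifT //; lia.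
rewrite (@gcat_funr (gcat p q)) ?plen_cat ?(ltnW qi) // gcat_funr; last by lia.
by rewrite subnDA.
Qed.

Lemma gcat1p p : gcat gtriv p = p.
Proof.
apply: gloop_eqP => // i; rewrite plen_cat => ile.
by rewrite visit_cat // gcat_funr // plen_triv subn0.
Qed.

Lemma gcatp1 p : gcat p gtriv = p.
Proof.
apply: gloop_eqP => [|i]; rewrite plen_cat plen_triv addn0 // => ile.
by rewrite visit_cat ?plen_triv ?addn0 // /gcat_fun ile.
Qed.

Lemma grevK p : grev (grev p) = p.
Proof.
apply: gloop_eqP => // i; rewrite !plen_rev => ile.
by rewrite visit_rev // visit_rev plen_rev ?leq_subr // subKn.
Qed.

Section Equivalence.
Variable m : nat.

Lemma gloop_equiv_map (F : gloop X -> gloop X) :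
  (forall p q, stretch p q -> stretch (F p) (F q)) ->
  (forall p q, jump m p q -> jump m (F p) (F q)) ->
  forall p q, gloop_equiv m p q -> gloop_equiv m (F p) (F q).
Proof.
move=> FA FB p q; elim=> {p q} [p q [/FA|/FB] ?|p|p q _|p q r _ pq _ qr].
- by apply: rst_step; left.
- by apply: rst_step; right.
- exact: rst_refl.
- exact: rst_sym.
- exact: rst_trans pq qr.
Qed.

Lemma gcat_equivl r p q : gloop_equiv m p q -> gloop_equiv m (gcat p r) (gcat q r).
Proof.
apply: (gloop_equiv_map (F := fun p => gcat p r)) => {}p {}q.
  move=> [lpq [x xp [pqx pqy]]]; split; first by rewrite !plen_cat lpq.
  exists x; first by rewrite ?plen_cat ?plen_rev; lia.
  split=> i ix; rewrite ?plen_cat ?plen_rev in ix *.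
    rewrite !visit_cat ?lpq; [|by lia..].
    by rewrite /gcat_fun !ifT ?lpq; [exact: pqx|by lia..].
  rewrite !visit_cat ?lpq; [|by lia..].
  have [ip|pi] := leqP i (plen p).
    by rewrite /gcat_fun !ifT ?lpq; [apply: pqy; lia|by lia..].
  rewrite !gcat_funr ?lpq; [|by lia..].
  by rewrite subSS.
move=> [lpq [i0 pq]]; split; first by rewrite !plen_cat lpq.
exists i0 => i; rewrite ?plen_cat ?plen_rev => ile ii0.
rewrite !visit_cat -?lpq // /gcat_fun -lpq.
by case: ifP => // ip; exact: pq.
Qed.

Lemma gcat_equivr r p q : gloop_equiv m p q -> gloop_equiv m (gcat r p) (gcat r q).
Proof.
apply: (gloop_equiv_map (F := gcat r)) => {}p {}q.
  move=> [lpq [x xp [pqx pqy]]]; split; first by rewrite !plen_cat lpq addnS.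
  exists (plen r + x); first by rewrite ?plen_cat ?plen_rev; lia.
  split=> i ix; rewrite ?plen_cat ?plen_rev in ix *.
    rewrite !visit_cat ?lpq; [|by lia..].
    by rewrite /gcat_fun; case: ifP => // ir; apply: pqx; lia.
  rewrite !visit_cat ?lpq; [|by lia..].
  rewrite !gcat_funr; [|by lia..].
  by rewrite subSn; [apply: pqy; lia|by lia].
move=> [lpq [i0 pq]]; split; first by rewrite !plen_cat lpq.
exists (plen r + i0) => i; rewrite ?plen_cat ?plen_rev => ile ii0.
rewrite !visit_cat -?lpq // /gcat_fun.
by case: ifP => // ip; apply: pq; lia.
Qed.

Lemma gcat_equiv p p' q q' : gloop_equiv m p p' -> gloop_equiv m q q' ->
  gloop_equiv m (gcat p q) (gcat p' q').
Proof.
by move=> pp qq; apply: rst_trans (gcat_equivl _ pp) (gcat_equivr _ qq).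
Qed.

Lemma grev_equiv p q : gloop_equiv m p q -> gloop_equiv m (grev p) (grev q).
Proof.
apply: (gloop_equiv_map (F := grev)) => {}p {}q.
  move=> [lpq [x xp [pqx pqy]]]; split=> //.
  exists (plen p - x); first by rewrite ?plen_cat ?plen_rev; lia.
  split=> i ix; rewrite ?plen_cat ?plen_rev in ix *.
    rewrite !visit_rev ?lpq; [|by lia..].
    by rewrite subSn; [apply: pqy; lia|by lia].
  rewrite !visit_rev ?lpq; [|by lia..].
  by rewrite subSS; apply: pqx; lia.
move=> [lpq [i0 pq]]; split=> //.
exists (plen p - i0 - m) => i; rewrite ?plen_cat ?plen_rev => ile ii0.
rewrite !visit_rev -?lpq //.
have [->|i_n0] := eqVneq i 0; first by rewrite subn0 visit_end lpq visit_end.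
by apply: pq; lia.
Qed.

Hypothesis m_ge2 : 2 <= m.

Section Fold.
Variable p : gloop X.

(* follow p along a reparametrization by a walk on the natural numbers *)
Lemma refold_step (g : nat -> nat) i :
  g i = g i.+1 \/ g i.+1 = (g i).+1 \/ g i = (g i.+1).+1 ->
  visit p (g i) = visit p (g i.+1) \/ adj (visit p (g i)) (visit p (g i.+1)).
Proof.
case=> [->|[->|->]]; [by left|exact: visit_step|].
by case: (visit_step p (g i.+1)) => [->|/adj_sym]; [left|right].
Qed.

Definition fold_idx (c j i : nat) : nat :=
  minn i (minn j (j + j + c - i)).

Lemma fold_stepP c j i : i < j + j + c ->
  visit p (fold_idx c j i) = visit p (fold_idx c j i.+1) \/
  adj (visit p (fold_idx c j i)) (visit p (fold_idx c j i.+1)).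
Proof. by move=> ij; apply: refold_step; rewrite /fold_idx; lia. Qed.

Lemma fold_start c j : visit p (fold_idx c j 0) = base X.
Proof. by rewrite /fold_idx min0n visit0. Qed.

Lemma fold_end c j : visit p (fold_idx c j (j + j + c)) = base X.
Proof.
by rewrite (_ : fold_idx c j _ = 0) ?visit0 // /fold_idx; lia.
Qed.

(* p up to time j, a pause of length c, and back *)
Definition fold c j : gloop X :=
  mk_gloop (@fold_stepP c j) (fold_start c j) (fold_end c j).

Lemma plen_fold c j : plen (fold c j) = j + j + c. Proof. by []. Qed.

Lemma visit_fold c j i : i <= j + j + c ->
  visit (fold c j) i = visit p (fold_idx c j i).
Proof. exact: visit_mk. Qed.

Lemma fold_stretch c j : stretch (fold c j) (fold c.+1 j).
Proof.
split; first by rewrite !plen_fold addnS.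
exists j; first by rewrite plen_fold; lia.
split=> i ij; rewrite ?plen_fold in ij *; rewrite !visit_fold; try by lia.
  by congr (visit p _); rewrite /fold_idx; lia.
by congr (visit p _); rewrite /fold_idx; lia.
Qed.

Lemma fold_jump j : jump m (fold 0 j.+1) (fold 2 j).
Proof.
split; first by rewrite !plen_fold; lia.
exists j => i; rewrite plen_fold => ij ij0; rewrite !visit_fold; try by lia.
by congr (visit p _); rewrite /fold_idx; lia.
Qed.

Lemma fold_triv j : gloop_equiv m (fold 0 j) gtriv.
Proof.
elim: j => [|j IHj].
  rewrite (_ : fold 0 0 = gtriv); first exact: rst_refl.
  apply: gloop_eqP => // i; rewrite plen_fold leqn0 => /eqP ->.
  by rewrite !visit0.
apply: rst_trans IHj.
apply: rst_trans (rst_step _ _ _ _ (or_intror (fold_jump j))) _.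
apply: rst_sym; apply: rst_trans; apply: rst_step; left; exact: fold_stretch.
Qed.

Lemma gcatpV : gloop_equiv m (gcat p (grev p)) gtriv.
Proof.
rewrite (_ : gcat _ _ = fold 0 (plen p)); first exact: fold_triv.
apply: gloop_eqP => [|i]; rewrite plen_cat plen_rev; first by rewrite /= addn0.
move=> ile.
rewrite visit_cat // visit_fold ?addn0 // /gcat_fun; case: ifP => ip.
  by congr (visit p _); rewrite /fold_idx; lia.
rewrite visit_rev; last by lia.
by congr (visit p _); rewrite /fold_idx; lia.
Qed.

End Fold.

Lemma gcatVp p : gloop_equiv m (gcat (grev p) p) gtriv.
Proof. by have := gcatpV (grev p); rewrite grevK. Qed.

Definition gloop_equivb p q := `[< gloop_equiv m p q >].

Lemma gloop_equivb_equiv : equiv_class_of gloop_equivb.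
Proof.
split=> [p|p q|q p r]; rewrite /gloop_equivb.
- exact/asboolP/rst_refl.
- by apply/asboolP/asboolP; exact: rst_sym.
- by move=> /asboolP pq /asboolP qr; apply/asboolP; exact: rst_trans pq qr.
Qed.

Canonical gloop_equiv_rel := EquivRelPack gloop_equivb_equiv.

(* inverses need m_ge2, hence the dependency of the type on it *)
Definition pi1m : Type := let _ := m_ge2 in {eq_quot gloop_equiv_rel}.

HB.instance Definition _ := EqQuotient.on pi1m.
HB.instance Definition _ := Choice.on pi1m.

Definition gloop_class p : pi1m := \pi_pi1m p.

Lemma gloop_classP p q : gloop_class p = gloop_class q <-> gloop_equiv m p q.
Proof. by split=> [/eqmodP/asboolP|pq]; last exact/eqmodP/asboolP. Qed.

Lemma gloop_class_surj (a : pi1m) : exists p, a = gloop_class p.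
Proof. by exists (repr a); rewrite /gloop_class reprK. Qed.

Lemma repr_gloop_class p : gloop_equiv m (repr (gloop_class p)) p.
Proof. by apply/gloop_classP; rewrite {1}/gloop_class reprK. Qed.

Definition pi1m_mul (a b : pi1m) : pi1m := gloop_class (gcat (repr a) (repr b)).
Definition pi1m_inv (a : pi1m) : pi1m := gloop_class (grev (repr a)).
Definition pi1m_one : pi1m := gloop_class gtriv.

Lemma pi1m_mulE p q :
  pi1m_mul (gloop_class p) (gloop_class q) = gloop_class (gcat p q).
Proof. by apply/gloop_classP; apply: gcat_equiv; exact: repr_gloop_class. Qed.

Lemma pi1m_invE p : pi1m_inv (gloop_class p) = gloop_class (grev p).
Proof. by apply/gloop_classP; apply: grev_equiv; exact: repr_gloop_class. Qed.

Lemma pi1m_mulA : associative pi1m_mul.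
Proof.
move=> a b c; have [p ->] := gloop_class_surj a.
have [q ->] := gloop_class_surj b; have [r ->] := gloop_class_surj c.
by rewrite !pi1m_mulE gcatA.
Qed.

Lemma pi1m_mul1 : left_id pi1m_one pi1m_mul.
Proof.
by move=> a; have [p ->] := gloop_class_surj a; rewrite pi1m_mulE gcat1p.
Qed.

Lemma pi1m_mulr1 : right_id pi1m_one pi1m_mul.
Proof.
by move=> a; have [p ->] := gloop_class_surj a; rewrite pi1m_mulE gcatp1.
Qed.

Lemma pi1m_mulV : left_inverse pi1m_one pi1m_inv pi1m_mul.
Proof.
move=> a; have [p ->] := gloop_class_surj a.
by rewrite pi1m_invE pi1m_mulE; apply/gloop_classP; exact: gcatVp.
Qed.

Lemma pi1m_mulrV : right_inverse pi1m_one pi1m_inv pi1m_mul.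
Proof.
move=> a; have [p ->] := gloop_class_surj a.
by rewrite pi1m_invE pi1m_mulE; apply/gloop_classP; exact: gcatpV.
Qed.

HB.instance Definition _ :=
  isGroup.Build pi1m pi1m_mulA pi1m_mul1 pi1m_mulr1 pi1m_mulV pi1m_mulrV.

End Equivalence.
End Loops.

Section ClosedFundamentalGroupMap.
Variables (X Y : based_graph) (f : based_map X Y).

Lemma gpush_mapP (p : gloop X) (i j : path_graph (plen p)) :
  adj i j -> f (pmap p i) = f (pmap p j) \/ adj (f (pmap p i)) (f (pmap p j)).
Proof. by move/(gmapP (pmap p)) => [->|/(gmapP f)]; [left|]. Qed.

Lemma gpush_start (p : gloop X) : f (pmap p ord0) = base Y.
Proof. by rewrite gloop_start bmapP. Qed.

Lemma gpush_end (p : gloop X) : f (pmap p ord_max) = base Y.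
Proof. by rewrite gloop_end bmapP. Qed.

Definition gpush (p : gloop X) : gloop Y :=
  @GLoop Y (@GPath Y (plen p) (GraphMap (@gpush_mapP p)))
    (gpush_start p) (gpush_end p).

Variables (m : nat) (m_ge2 : 2 <= m).

Definition pi1m_map (a : pi1m X m_ge2) : pi1m Y m_ge2 :=
  gloop_class m_ge2 (gpush (repr a)).

Lemma gpush_equiv (p q : gloop X) :
  gloop_equiv m p q -> gloop_equiv m (gpush p) (gpush q).
Proof.
elim=> {p q} [p q [[lpq [x xp [pqx pqy]]]|[lpq [i0 pq]]]|p|p q _|p q r _ pq _ qr].
- apply: rst_step; left; split=> //; exists x => //.
  by split=> i ix; congr (f _); [exact: pqx|exact: pqy].
- apply: rst_step; right; split=> //; exists i0 => i ip ii0.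
  by congr (f _); exact: pq.
- exact: rst_refl.
- exact: rst_sym.
- exact: rst_trans pq qr.
Qed.

Lemma pi1m_mapE (p : gloop X) :
  pi1m_map (gloop_class m_ge2 p) = gloop_class m_ge2 (gpush p).
Proof. by apply/gloop_classP/gpush_equiv; exact: repr_gloop_class. Qed.

End ClosedFundamentalGroupMap.

Lemma double_ge2 (k : nat) : 0 < k -> 2 <= 2 * k.
Proof. by lia. Qed.

(* Main.v *)
(* A loop in G is sent to the piecewise linear loop through the vertices it
   visits. A jump of length 2k at time i0 is a homotopy: both pieces lie in
   balls of radius k around their midpoints, so both contract to the edge
   joining their common ends. For injectivity, subdivide a homotopy so finely
   that every small square maps to an open star, and replace each edge
   {a, b} of the resulting grid of vertices by a walk of length 2k in G through
   a common centre of a and b. For a, b, d in one ball the walks a -> b -> d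
   and a -> d are equivalent, hence so are the walks read off from consecutive
   rows. For surjectivity, subdivide a loop into pieces mapped to
   stars; the loop is linearly homotopic to the polygon of star centres, and the
   polygon to the walk that joins these centres through the balls. *)
Require Import Defs.
From HB Require Import structures.
From Stdlib Require Import Relation_Operators.
From mathcomp Require Import all_boot all_order all_algebra finmap.
From mathcomp Require Import all_classical all_reals all_analysis.
From mathcomp Require Import homotopy lra zify.

Set Implicit Arguments.
Unset Strict Implicit.
Unset Printing Implicit Defensive.

Import Order.TTheory GRing.Theory Num.Theory.
Import numFieldNormedType.Exports.

Local Open Scope classical_set_scope.
Local Open Scope ring_scope.

(** * Maps into the realization *)

Lemma open_preimage (T U : topologicalType) (f : T -> U) (A : set U) :
  continuous f -> open A -> open (f @^-1` A).
Proof. by move/continuousP; apply. Qed.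

Lemma open_neq0 (R : realType) : open [set r : R | r != 0].
Proof.
rewrite (_ : [set r : R | r != 0] = ~` [set 0]).
  by apply: closed_openC; exact: closed_eq.
by apply/seteqP; split=> r /= /eqP.
Qed.

Section RealizationTopology.
Variables (R : realType) (K : simplicial_complex).
Local Notation rK := (realization R K).

Definition supp (x : rK) : set K := [set v | x v != 0].

Lemma coord_continuous (v : K) : continuous (fun x : rK => x v).
Proof.
apply/continuousP => U oU; apply/openE_realization => s Ks.
apply: open_subspaceW.
exists ((fun b : {ptws K -> R} => b v) @^-1` U) => //.
exact: (@open_preimage {ptws K -> R} _ (fun b => b v) _
    (@proj_continuous K (fun=> R) v)).
Qed.

Lemma open_star (v : K) : open [set x : rK | x v != 0].
Proof. exact: (open_preimage (@coord_continuous v) (@open_neq0 R)). Qed.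

(** Only subsets of the finite set [V] can support a point [f t'], so finitely many conditions, one
    per cell, have to hold near [t], and on a single cell the coherent topology is given by the
    coordinates. *)
Lemma finite_support_continuous (T : topologicalType) (f : T -> rK)
    (V : set K) :
  finite_set V -> (forall t, supp (f t) `<=` V) ->
  (forall v, continuous (fun t => f t v)) -> continuous f.
Proof.
move=> finV fV cf t U; rewrite nbhsE => -[W [/openE_realization oW Wt] WU].
have coordc : continuous (fun t => Defs.coord (f t) : {ptws K -> R}).
  exact: cts_ptws.
pose V' := fset_set V.
pose P (s : {fset K}) := [set t' | supp (f t') `<=` [set` s] ->
  simplex K [set` s] -> U (f t')].
have nP : nbhs t (\bigcap_(s in [set` fpowerset V']) P s).
  apply: filter_bigI => s _.
  have [Ks|nKs] := pselect (simplex K [set` s]); last first.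
    by apply: filterE => t' _ /nKs.
  (* If the support of [f t] is not inside [s], some coordinate outside [s] stays nonzero near [t],
     which makes [P s] vacuous there. *)
  have [ts|/existsNP[v /not_implyP[tv sv]]] :=
    pselect (supp (f t) `<=` [set` s]); last first.
    have : nbhs t [set t' | f t' v != 0].
      apply: (cf v t [set r : R | r != 0]).
      by apply: open_nbhs_nbhs; split; [exact: (@open_neq0 R)|exact: tv].
    by apply: filterS => t' tv' /(_ v tv') /sv.
  have /open_subspaceP[V1 [A oA VA] VW] := oW _ Ks.
  have : nbhs t [set t' | A (Defs.coord (f t'))].
    apply: (coordc t A); apply: open_nbhs_nbhs; split=> //.
    have : (W `&` cell [set` s]) (f t) by split.
    by rewrite -VW -VA => -[].
  apply: filterS => t' At' st' _; apply: WU.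
  have : (V1 `&` cell [set` s]) (f t') by rewrite -VA; split.
  by rewrite VW => -[].
apply: filterS nP => t' Pt'.
have fin : finite_set (supp (f t')) := fin_support (f t').
apply: (Pt' (fset_set (supp (f t')))) => /=.
- rewrite fpowersetE; apply/fsubsetP => v; rewrite !in_fset_set //.
  by rewrite !inE => /fV.
- by rewrite fset_setK.
- by rewrite fset_setK //; exact: coord_simplex.
Qed.

(** Coordinates separate points, so the coordinate topology is Hausdorff. *)
Lemma coord_topology_finite_closed (A : set rK) :
  finite_set A -> closed (A : set (coord_topology R K)).
Proof.
suff hT : hausdorff_space (coord_topology R K).
  exact: (iffLR (@accessible_finite_set_closed (coord_topology R K))
    (hausdorff_accessible hT)).
move=> {A} x y cl; apply: (@realization_eqP R K) => v; apply/eqP/negPn/negP => /eqP xy.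
have : hausdorff_space R by exact: Rhausdorff.
rewrite open_hausdorff => /(_ (x v) (y v)) [|[A B] /= [xA yB] [oA oB AB]].
  exact/eqP.
have op (z : coord_topology R K) C : open C -> C (Defs.coord z v) ->
    nbhs z [set w : coord_topology R K | C (Defs.coord w v)].
  move=> oC Cz; apply: open_nbhs_nbhs; split=> //.
  exists ((fun b : {ptws K -> R} => b v) @^-1` C) => //.
  exact: (@open_preimage {ptws K -> R} _ (fun b => b v) _
    (@proj_continuous K (fun=> R) v)).
have [] := cl _ _ (op x A oA (set_mem xA)) (op y B oB (set_mem yB)).
by move=> z [/= Az Bz]; have : (A `&` B) (Defs.coord z v) by []; rewrite (eqP AB).
Qed.

(** Openness in the realization is tested on cells, and on each of them the complement of [A] is
    traced by the complement of a finite set. *)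
Lemma cellwise_finite_closed (A : set rK) :
  (forall s, simplex K s -> finite_set (A `&` cell s)) -> closed A.
Proof.
move=> fA; rewrite -[A]setCK; apply: open_closedC.
apply/openE_realization => s Ks; apply/open_subspaceP.
exists (~` (A `&` cell s)).
  by apply: closed_openC; apply: coord_topology_finite_closed; exact: fA.
by apply/seteqP; split=> x /= [nA sx]; split=> //; [move=> Ax; apply: nA
  |move=> [/nA]].
Qed.

(* Pick for each vertex v met by the image a point x v whose support contains
   v. Any set of such points meets each cell in finitely many points, hence is
   closed; discarding those with v in the support of f t leaves a neighbourhood
   of t that meets only finitely many of them. *)
Lemma compact_finite_support (T : ptopologicalType) (A : set T) (f : T -> rK) :
  compact A -> continuous f -> finite_set (\bigcup_(t in A) supp (f t)).
Proof.
move=> cA cf; set V0 := \bigcup_(t in _) _.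
have /choice[g gV] : forall v, exists x : rK,
    V0 v -> x v != 0 /\ exists2 t, A t & x = f t.
  move=> v; have [[t At tv]|nv] := pselect (V0 v).
    by exists (f t) => _; split=> //; exists t.
  by exists (vertex_point R v).
pose W (t : T) := f @^-1` ~` (g @` (V0 `\` supp (f t))).
have oW t : open (W t).
  apply: (open_preimage cf); apply: closed_openC.
  apply: cellwise_finite_closed => s /simplex_finite fs.
  apply: (@sub_finite_set rK _ (g @` s)); last exact: finite_image.
  move=> _ [[v [Vv _] <-]] /= sv.
  by exists v => //; apply: sv; exact: (gV v Vv).1.
have tW t : W t t.
  by move=> /= [v [Vv tv] gvt]; apply: tv; rewrite -gvt; exact: (gV v Vv).1.
move: cA; rewrite compact_cover => /(_ T setT W) [//|t _|D _ cD].
  by exists t => //; exact: tW.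
apply: (@sub_finite_set _ _ (\bigcup_(t in [set` D]) supp (f t))); last first.
  by apply: bigcup_finite => // t _; exact: fin_support.
move=> v Vv; have [gvv [t At gvt]] := gV v Vv.
have [u Du Wut] := cD t At; exists u => //.
by apply: contrapT => nuv; apply: Wut; exists v.
Qed.

(** Precomposing with [clamp] moves the question to the real line, where the segment from 0 to 1 is
    compact. *)
Lemma loop_finite_support (p : unit_interval R -> rK) :
  continuous p ->
  finite_set (\bigcup_(s in [set: unit_interval R]) supp (p s)).
Proof.
move=> cp; apply: (@sub_finite_set _ _
  (\bigcup_(t in `[0, 1]%classic) supp (p (clamp t)))); last first.
  apply: (@compact_finite_support R _ (p \o @clamp R)).
    exact: segment_compact.
  by apply: cts_comp cp; exact: clamp_continuous.
move=> v [s _ sv]; exists (ivl s); last by rewrite /= clamp_ivl.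
by rewrite /= in_itv /= ivl_ge0 ivl_le1.
Qed.

(* The values t outside [0, 1], or x and y without a common simplex, are junk. *)
Definition mix (t : R) (x y : rK) : rK :=
  xget x [set z : rK | forall v, z v = (1 - t) * x v + t * y v].

Lemma mixE (t : R) (x y : rK) : 0 <= t <= 1 ->
  simplex K (supp x `|` supp y) ->
  forall v, mix t x y v = (1 - t) * x v + t * y v.
Proof.
move=> /andP[t0 t1] Kxy; rewrite /mix; case: xgetP => [//|nz].
pose c v := (1 - t) * x v + t * y v.
have c_ge0 v : 0 <= c v.
  by rewrite addr_ge0 // mulr_ge0 ?subr_ge0 // coord_ge0.
have c_supp : [set v | c v != 0] `<=` supp x `|` supp y.
  move=> v; rewrite /supp /c /= => cv; apply: contrapT.
  move=> /not_orP[/negP/negPn/eqP xv /negP/negPn/eqP yv].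
  by rewrite xv yv !mulr0 addr0 eqxx in cv.
have c_simplex := simplex_sub c_supp Kxy.
have fin := simplex_finite Kxy.
have c_sum : \sum_(v \in [set: K]) c v = 1.
  have sumE (h : K -> R) : [set v | h v != 0] `<=` supp x `|` supp y ->
      \sum_(v \in [set: K]) h v =
      \sum_(v <- finmap.enum_fset (fset_set (supp x `|` supp y))) h v.
    move=> hs; rewrite -(fsbig_widen (supp x `|` supp y)) ?fsbig_finite //.
    move=> v /= [_ nv]; apply/eqP; apply: contrapT => /negP hv.
    by apply: nv; exact: hs.
  have xs := coord_sum1 x; have ys := coord_sum1 y.
  rewrite sumE in xs; last by move=> v; left.
  rewrite sumE in ys; last by move=> v; right.
  by rewrite sumE // big_split /= -!mulr_sumr xs ys !mulr1 subrK.
by have := nz (Realization c_ge0 c_simplex c_sum); case.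
Qed.

(** The straight-line homotopy is supported in the union of the supports met by [p] and [q]. This
    set is finite by compactness, so continuity can be checked coordinate by coordinate. *)
Lemma linear_homotopy (x : rK) (p q : {path (unit_interval R) from x to x}) :
  (forall s, simplex K (supp (p s) `|` supp (q s))) ->
  loop_homotopic p q.
Proof.
move=> pq.
have ivl01 (t : unit_interval R) : 0 <= ivl t <= 1.
  by rewrite ivl_ge0 ivl_le1.
have coordE (st : unit_interval R * unit_interval R) v :
    mix (ivl st.2) (p st.1) (q st.1) v =
    (1 - ivl st.2) * p st.1 v + ivl st.2 * q st.1 v.
  exact: mixE.
have cp : continuous p by exact: cts_fun.
have cq : continuous q by exact: cts_fun.
exists (fun st => mix (ivl st.2) (p st.1) (q st.1)); split=> [|s|s|t].
- apply: (@finite_support_continuous _ _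
    ((\bigcup_(s in [set: unit_interval R]) supp (p s)) `|`
     (\bigcup_(s in [set: unit_interval R]) supp (q s)))).
  + by rewrite finite_setU; split; exact: loop_finite_support.
  + move=> st v; rewrite /supp /= coordE => pqv; apply: contrapT.
    move=> /not_orP[np nq].
    have [pv|pv] := eqVneq (p st.1 v) 0; last by apply: np; exists st.1.
    have [qv|qv] := eqVneq (q st.1 v) 0; last by apply: nq; exists st.1.
    by rewrite pv qv !mulr0 addr0 eqxx in pqv.
  + move=> v; rewrite (funext (coordE ^~ v)).
    have cpv : continuous (fun st : unit_interval R * unit_interval R =>
        p st.1 v).
      apply: (@cts_comp _ _ _ (fun st : _ * unit_interval R => p st.1)
        (fun y : rK => y v)); last exact: coord_continuous.
      by apply: (cts_comp (g := p)) => //; cts.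
    have cqv : continuous (fun st : unit_interval R * unit_interval R =>
        q st.1 v).
      apply: (@cts_comp _ _ _ (fun st : _ * unit_interval R => q st.1)
        (fun y : rK => y v)); last exact: coord_continuous.
      by apply: (cts_comp (g := q)) => //; cts.
    by cts.
- by apply: realization_eqP => v; rewrite coordE ivl0 subr0 mul1r mul0r addr0.
- by apply: realization_eqP => v; rewrite coordE ivl1 subrr mul0r mul1r add0r.
- by split; apply: realization_eqP => v;
    rewrite coordE /= ?path_zero ?path_one -mulrDl subrK mul1r.
Qed.

Lemma support_neq0 (x : rK) : exists v, supp x v.
Proof.
apply: contrapT => nx; have := coord_sum1 x.
rewrite fsbig1 => [/esym/eqP|v _]; first by rewrite oner_eq0.
by apply/eqP; apply: contrapT => /negP xv; apply: nx; exists v.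
Qed.

(* A Lebesgue number for the cover of the square by preimages of open stars. *)
Lemma star_grid (H : unit_interval R * unit_interval R -> rK) :
  continuous H ->
  exists N, (0 < N)%N /\ exists v : nat -> nat -> K,
    forall i j (s t : unit_interval R), (i <= N)%N -> (j <= N)%N ->
      `|N%:R * ivl s - i%:R| <= 1 -> `|N%:R * ivl t - j%:R| <= 1 ->
      H (s, t) (v i j) != 0.
Proof.
move=> cH; pose H' (z : R * R) := H (clamp z.1, clamp z.2).
have cH' : continuous H' by apply: cts_comp cH; cts.
(* [P n z]: the closed square of half-side 1/(n+1) about [z] is mapped into a single open star. *)
pose P (n : nat) (z : R * R) := exists v, forall z' : R * R,
  `|z.1 - z'.1| <= n.+1%:R^-1 -> `|z.2 - z'.2| <= n.+1%:R^-1 -> H' z' v != 0.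
pose Q : set (R * R) := `[0, 1]%classic `*` `[0, 1]%classic.
have cQ : compact Q by apply: compact_setX; exact: segment_compact.
have : \forall n \near \oo, Q `<=` P n.
  move/compact_near_coveringP: cQ; apply => z _.
  have [v zv] := support_neq0 (H' z).
  have : nbhs z [set z' | H' z' v != 0].
    apply: (cH' z [set x : rK | x v != 0]).
    by apply: open_nbhs_nbhs; split; [exact: open_star|exact: zv].
  move=> /nbhs_ballP[e /= e0 ze].
  have e20 : 0 < e / 2 by rewrite divr_gt0.
  (* Half of the radius [e] is spent on moving the centre [z], the other half on the size of the
     square. *)
  exists (ball z (e / 2), [set n | n.+1%:R^-1 < e / 2]) => /=.
    by split; [exact: nbhsx_ballx|exact: near_infty_natSinv_lt (PosNum e20)].
  move=> [z' n] /= [zz' ne]; exists v => z'' d1 d2; apply: ze.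
  case: zz' => zz1 zz2.
  split; rewrite (splitr e).
    by apply: ball_triangle zz1 _; rewrite /ball /= (le_lt_trans d1).
  by apply: ball_triangle zz2 _; rewrite /ball /= (le_lt_trans d2).
move=> /filter_ex[n Pn]; exists n.+1; split=> //.
have N0 : 0 < n.+1%:R :> R by rewrite ltr0n.
have /choice[v vP] : forall ij : nat * nat, exists v,
    forall s t : unit_interval R, (ij.1 <= n.+1)%N -> (ij.2 <= n.+1)%N ->
      `|n.+1%:R * ivl s - ij.1%:R| <= 1 -> `|n.+1%:R * ivl t - ij.2%:R| <= 1 ->
      H (s, t) v != 0.
  (* Off the grid the claim is vacuous and any vertex serves. *)
  move=> [i j] /=; have [/andP[iN jN]|ij] := boolP ((i <= n.+1) && (j <= n.+1))%N;
    last first.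
    have [v _] := support_neq0 (H (zero, zero)); exists v => s t iN jN.
    by rewrite iN jN in ij.
  have [|v vP] := Pn (i%:R / n.+1%:R, j%:R / n.+1%:R).
    by split; rewrite /= in_itv /= divr_ge0 ?ler0n // ler_pdivrMr // mul1r ler_nat.
  exists v => s t _ _ si tj.
  have close (l : nat) (r : R) : `|n.+1%:R * r - l%:R| <= 1 ->
      `|l%:R / n.+1%:R - r| <= n.+1%:R^-1.
    move=> lr; rewrite -(ler_pM2l N0) divff ?gt_eqF // distrC.
    rewrite -{1}(ger0_norm (ltW N0)) -normrM mulrBr mulrCA divff ?gt_eqF //.
    by rewrite mulr1.
  have := vP (ivl s, ivl t) (close _ _ si) (close _ _ tj).
  by rewrite /H' !clamp_ivl.
by exists (fun i j => v (i, j)) => i j; exact: (vP (i, j)).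
Qed.

End RealizationTopology.

(** * Piecewise linear loops *)

Section PiecewiseLinear.
Variable R : realType.
Implicit Types (h : nat -> R) (u : R).

(* The piecewise linear function through the points (i, h i), i <= N, extended
   by constants on both sides. *)
Definition pl h (N : nat) u : R :=
  h 0%N + \sum_(i < N) (h i.+1 - h i) * ivl (clamp (u - i%:R)).

Lemma eq_pl h h' N : (forall i, (i <= N)%N -> h i = h' i) -> pl h N =1 pl h' N.
Proof.
move=> hh' u; rewrite /pl hh' //; congr (_ + _); apply: eq_bigr => i _.
by rewrite !hh' // ltnW.
Qed.

Lemma pl_continuous (T : topologicalType) h N (f : T -> R) :
  continuous f -> continuous (fun t => pl h N (f t)).
Proof.
move=> cf; apply: (@cts_add _ _ (fun=> h 0%N)); first by cts.
elim: N => [|N IH].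
  rewrite (_ : (fun _ => _) = fun=> 0); first by cts.
  by apply/funext => t; rewrite big_ord0.
rewrite (_ : (fun _ => _) = fun t =>
    \sum_(i < N) (h i.+1 - h i) * ivl (clamp (f t - i%:R)) +
    (h N.+1 - h N) * ivl (clamp (f t - N%:R))); first by cts.
by apply/funext => t; rewrite big_ord_recr.
Qed.

Lemma pl_le0 h N u : u <= 0 -> pl h N u = h 0%N.
Proof.
move=> u0; rewrite /pl big1 ?addr0 // => i _.
by rewrite clamp_le0 ?ivl0 ?mulr0 // subr_le0 (le_trans u0).
Qed.

Lemma pl_ge h N u : N%:R <= u -> pl h N u = h N.
Proof.
move=> Nu; rewrite /pl (eq_bigr (fun i : 'I_N => h i.+1 - h i)) => [|i _].
  by rewrite -(big_mkord xpredT (fun i => h i.+1 - h i)) telescope_sumr // addrC subrK.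
rewrite clamp_ge1 ?ivl1 ?mulr1 // lerBrDr (le_trans _ Nu) //.
by rewrite nat1r ler_nat.
Qed.

(** Each piece is constant beyond the joint at [n], so the value [h n] is counted twice and
    subtracted once. *)
Lemma pl_add h n m u :
  pl h (n + m) u = pl h n u + pl (fun i => h (n + i)%N) m (u - n%:R) - h n.
Proof.
rewrite /pl big_split_ord /= addn0 -!addrA; congr (_ + (_ + _)).
rewrite [RHS]addrC subrK; apply: eq_bigr => i _.
by rewrite addnS natrD opprD addrA.
Qed.

Lemma pl_segment h N l u : (l < N)%N -> l%:R <= u <= l%:R + 1 ->
  pl h N u = (1 - (u - l%:R)) * h l + (u - l%:R) * h l.+1.
Proof.
(* Cut off what precedes and what follows the [l]-th segment: both parts are constant at [u]. *)
move=> lN /andP[lu ul]; rewrite -(subnKC lN) -addn1 -addnA !pl_add.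
rewrite (pl_ge _ lu) [X in _ + (_ + X - _)]pl_le0; last by lra.
rewrite /pl big_ord1 ivl_clamp ?subr0; last by lra.
by rewrite !addn0 addn1; lra.
Qed.

Lemma in_segment N u : (0 < N)%N -> 0 <= u <= N%:R ->
  exists2 l, (l < N)%N & l%:R <= u <= l%:R + 1.
Proof.
elim: N => // -[_ _ u01|N IH _ /andP[u0 uN]]; first by exists 0%N; rewrite ?add0r.
have [uN1|uN1] := leP u N.+1%:R.
  by have [|l lN lu] := IH isT; [rewrite u0|exists l => //; exact: leqW].
by exists N.+1; rewrite // (ltW uN1) natr1.
Qed.

Lemma in_segment_mul (N : nat) (s : unit_interval R) : (0 < N)%N ->
  exists2 l, (l < N)%N & l%:R <= N%:R * ivl s <= l%:R + 1.
Proof.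
move=> N0; apply: in_segment => //; rewrite mulr_ge0 ?ler0n ?ivl_ge0 //=.
by rewrite ler_piMr ?ler0n // ivl_le1.
Qed.

End PiecewiseLinear.

Section RealReparametrization.
Variables (R : realType) (X : topologicalType) (x : X) (L : R -> X) (a : R).
Hypotheses (cL : continuous L) (L_out : forall u, u <= 0 \/ a <= u -> L u = x).

(** The parameters are interpolated linearly in the real line. They may overshoot the interval from
    0 to [a], because [L] takes the value [x] outside it, which keeps the endpoints fixed. *)
Lemma real_reparam_homotopic (p q : {path (unit_interval R) from x to x})
    (phi psi : unit_interval R -> R) :
  continuous phi -> continuous psi ->
  phi zero <= 0 -> psi zero <= 0 -> a <= phi one -> a <= psi one ->
  (forall s, p s = L (phi s)) -> (forall s, q s = L (psi s)) ->
  loop_homotopic p q.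
Proof.
move=> cphi cpsi phi0 psi0 phi1 psi1 pE qE.
exists (fun st => L ((1 - ivl st.2) * phi st.1 + ivl st.2 * psi st.1)).
have cphi' : continuous (fun st : unit_interval R * unit_interval R => phi st.1).
  by apply: (cts_comp (g := phi)) => //; cts.
have cpsi' : continuous (fun st : unit_interval R * unit_interval R => psi st.1).
  by apply: (cts_comp (g := psi)) => //; cts.
split=> [|s|s|t] /=.
- by apply: (cts_comp (g := L)) => //; cts.
- by rewrite ivl0 subr0 mul1r mul0r addr0.
- by rewrite ivl1 subrr mul1r mul0r add0r.
- have t0 := ivl_ge0 t; have t1 := ivl_le1 t.
  by split; apply: L_out; [left; nra|right; nra].
Qed.

End RealReparametrization.

Section EdgeLoops.
Variables (R : realType) (K : simplicial_complex).
Local Notation rK := (realization R K).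
Local Notation I := (unit_interval R).
Implicit Types f g : nat -> K.

Definition edge_seq f N :=
  forall i, (i < N)%N -> simplex K [set f i; f i.+1].

(* Only meaningful when edge_seq f N holds. *)
Definition edge_point f N (u : R) : rK :=
  xget (vertex_point R (f 0%N))
    [set z : rK | forall v, z v = pl (fun i => vertex_coord R (f i) v) N u].

Lemma support_vertex (v : K) : supp (vertex_point R v) = [set v].
Proof. exact: vertex_coord_support. Qed.

Lemma edge_pointE f N u : edge_seq f N ->
  forall v, edge_point f N u v = pl (fun i => vertex_coord R (f i) v) N u.
Proof.
move=> ef; rewrite /edge_point; case: xgetP => // nz.
have [u0|u0] := leP u 0.
  by have [] := nz (vertex_point R (f 0%N)) => v; rewrite pl_le0.
have [uN|uN] := leP N%:R u.
  by have [] := nz (vertex_point R (f N)) => v; rewrite pl_ge.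
have N0 : (0 < N)%N.
  by case: N uN {ef nz} => // u0'; have := lt_trans u0 u0'; rewrite ltxx.
have [|l lN lu] := @in_segment R N u N0; first by rewrite (ltW u0) ltW.
(* Inside a segment the wanted point is a convex combination of the two end vertices. *)
have [] := nz (mix (u - l%:R) (vertex_point R (f l)) (vertex_point R (f l.+1))).
move=> v; rewrite (pl_segment _ lN lu) mixE //; first by lra.
by rewrite !support_vertex; exact: ef.
Qed.

Lemma edge_point_le0 f N u : edge_seq f N -> u <= 0 ->
  edge_point f N u = vertex_point R (f 0%N).
Proof.
by move=> ef u0; apply: realization_eqP => v; rewrite edge_pointE // pl_le0.
Qed.

Lemma edge_point_ge f N u : edge_seq f N -> N%:R <= u ->
  edge_point f N u = vertex_point R (f N).
Proof.
by move=> ef uN; apply: realization_eqP => v; rewrite edge_pointE // pl_ge.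
Qed.

Lemma edge_point_segment f N l u : edge_seq f N -> (l < N)%N ->
  l%:R <= u <= l%:R + 1 ->
  forall v, edge_point f N u v =
    (1 - (u - l%:R)) * vertex_coord R (f l) v +
    (u - l%:R) * vertex_coord R (f l.+1) v.
Proof. by move=> ef lN lu v; rewrite edge_pointE // (pl_segment _ lN lu). Qed.

Lemma support_edge_point f N l u : edge_seq f N -> (l < N)%N ->
  l%:R <= u <= l%:R + 1 ->
  supp (edge_point f N u) `<=` [set f l; f l.+1].
Proof.
move=> ef lN lu v; rewrite /supp /= (edge_point_segment ef lN lu).
rewrite /vertex_coord; have [->|_] := eqVneq v (f l); first by left.
have [->|_] := eqVneq v (f l.+1); first by right.
by rewrite !mulr0 addr0 eqxx.
Qed.

Lemma support_edge_point_range f N u : edge_seq f N ->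
  supp (edge_point f N u) `<=` f @` `I_N.+1.
Proof.
move=> ef; have [u0|u0] := leP u 0.
  by rewrite edge_point_le0 // support_vertex => _ ->; exists 0%N.
have [uN|uN] := leP N%:R u.
  by rewrite edge_point_ge // support_vertex => _ ->; exists N => /=.
have N0 : (0 < N)%N.
  by case: N uN {ef} => // u0'; have := lt_trans u0 u0'; rewrite ltxx.
have [|l lN lu] := @in_segment R N u N0; first by rewrite (ltW u0) ltW.
move=> v /(support_edge_point ef lN lu)[->|->].
  by exists l => //=; exact: leqW.
by exists l.+1.
Qed.

Lemma edge_point_continuous f N : edge_seq f N -> continuous (edge_point f N).
Proof.
move=> ef; apply: (@finite_support_continuous _ _ _ _ (f @` `I_N.+1)).
- exact/finite_image/finite_II.
- by move=> u; exact: support_edge_point_range.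
- move=> v; rewrite (funext (fun u => edge_pointE u ef v)).
  by apply: pl_continuous; cts.
Qed.

Section EdgeLoop.
Variables (b : K) (f : nat -> K) (N : nat).
Hypotheses (ef : edge_seq f N) (f0 : f 0%N = b) (fN : f N = b).

Let edge_fun (s : I) := edge_point f N (N%:R * ivl s).

Lemma edge_fun_continuous : continuous edge_fun.
Proof.
by apply: (cts_comp (g := edge_point f N)); [cts|exact: edge_point_continuous].
Qed.

Lemma edge_fun_zero : edge_fun zero = vertex_point R b.
Proof. by rewrite /edge_fun ivl0 mulr0 edge_point_le0 // f0. Qed.

Lemma edge_fun_one : edge_fun one = vertex_point R b.
Proof. by rewrite /edge_fun ivl1 mulr1 edge_point_ge // fN. Qed.

Definition edge_loop : {path I from vertex_point R b to vertex_point R b} :=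
  mk_path edge_fun_continuous edge_fun_zero edge_fun_one.

Lemma edge_loopE s : edge_loop s = edge_point f N (N%:R * ivl s).
Proof. by []. Qed.

Lemma edge_point_out u : u <= 0 \/ N%:R <= u ->
  edge_point f N u = vertex_point R b.
Proof. by case=> uN; [rewrite edge_point_le0 // f0|rewrite edge_point_ge // fN]. Qed.

End EdgeLoop.

Lemma eq_edge_loop b f g N (ef : edge_seq f N) (eg : edge_seq g N)
    (f0 : f 0%N = b) (fN : f N = b) (g0 : g 0%N = b) (gN : g N = b) :
  (forall i, (i <= N)%N -> f i = g i) ->
  edge_loop ef f0 fN = edge_loop eg g0 gN.
Proof.
move=> fg; apply/path_eqP => s; apply: realization_eqP => v.
rewrite !edge_loopE !edge_pointE //; apply: eq_pl => i iN.
by rewrite fg.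
Qed.

(** At each time the two points lie in the closed cell of one common simplex, so the straight-line
    homotopy exists. *)
Lemma contiguous_edge_loops b f g N (ef : edge_seq f N) (eg : edge_seq g N)
    (f0 : f 0%N = b) (fN : f N = b) (g0 : g 0%N = b) (gN : g N = b) :
  (forall i, (i < N)%N -> simplex K ([set f i; f i.+1] `|` [set g i; g i.+1])) ->
  loop_homotopic (edge_loop ef f0 fN) (edge_loop eg g0 gN).
Proof.
move=> fg; apply: linear_homotopy => s; rewrite !edge_loopE.
have [N0|N0] := posnP N.
  subst N; rewrite !mul0r !edge_point_le0 // !support_vertex f0 g0 setUid.
  exact: simplex1.
have [l lN ls] := in_segment_mul s N0.
by apply: simplex_sub (fg l lN); apply: setUSS; exact: support_edge_point.
Qed.

(** Both sides run along the polygon [edge_point f (n + m)]; the concatenation covers the first [n]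
    edges in the first half of the time and the other [m] in the second half. *)
Lemma concat_edge_loops b f n m (ef : edge_seq f (n + m)) (en : edge_seq f n)
    (em : edge_seq (fun i => f (n + i)%N) m) (f0 : f 0%N = b) (fn : f n = b)
    (fn' : f (n + 0)%N = b) (fnm : f (n + m)%N = b) (fnm' : f (n + m)%N = b) :
  loop_homotopic (edge_loop ef f0 fnm)
    (concat (edge_loop en f0 fn) (edge_loop em fn' fnm')).
Proof.
apply: (@real_reparam_homotopic _ _ _ (edge_point f (n + m)) (n + m)%:R _ _ _ _
  (fun s => (n + m)%:R * ivl s)
  (fun s => n%:R * ivl (clamp (2 * ivl s)) + m%:R * ivl (clamp (2 * ivl s - 1)))).
- exact: edge_point_continuous.
- exact: edge_point_out.
- by cts.
- by cts.
- by rewrite ivl0 mulr0.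
- by rewrite !clamp_le0 ?ivl0 ?mulr0 ?addr0 //; lra.
- by rewrite ivl1 mulr1.
- by rewrite !clamp_ge1 ?ivl1 ?mulr1 -?natrD //; lra.
- by move=> s; rewrite edge_loopE.
move=> s; rewrite /= /mk_path /= /concat_fun; case: leP => s2.
  rewrite [clamp (_ - 1)]clamp_le0 ?ivl0 ?mulr0 ?addr0; last by lra.
  apply: realization_eqP => v; rewrite edge_loopE !edge_pointE // pl_add.
  rewrite [X in _ + X - _]pl_le0 ?addn0 ?addrK //.
  by rewrite subr_le0 ler_piMr ?ler0n // ivl_le1.
rewrite [clamp (2 * ivl s)]clamp_ge1 ?ivl1 ?mulr1; last by lra.
apply: realization_eqP => v; rewrite edge_loopE !edge_pointE // pl_add.
rewrite [X in _ = X + _ - _]pl_ge; last first.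
  by rewrite lerDl mulr_ge0 ?ler0n ?ivl_ge0.
by rewrite [RHS]addrAC subrr add0r [in RHS]addrAC subrr add0r.
Qed.

Lemma stretch_edge_loop b f g n x (ef : edge_seq f n) (eg : edge_seq g n.+1)
    (f0 : f 0%N = b) (fn : f n = b) (g0 : g 0%N = b) (gn : g n.+1 = b) :
  (x <= n)%N -> (forall i, (i <= x)%N -> f i = g i) ->
  (forall i, (x <= i <= n)%N -> f i = g i.+1) ->
  loop_homotopic (edge_loop ef f0 fn) (edge_loop eg g0 gn).
Proof.
move=> xn fg_le fg_ge.
(* [rho] stands still at [x] between [x] and [x + 1] and lags by 1 afterwards, so the polygon of [g]
   at [u] is that of [f] at [rho u]. *)
pose rho (u : R) := Num.min u (Num.max x%:R (u - 1)).
have xnR : (x%:R <= n%:R :> R) by rewrite ler_nat.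
apply: (@real_reparam_homotopic _ _ _ (edge_point f n) n%:R _ _ _ _
  (fun s => n%:R * ivl s) (fun s => rho (n.+1%:R * ivl s))).
- exact: edge_point_continuous.
- exact: edge_point_out.
- by cts.
- by rewrite /rho; cts.
- by rewrite ivl0 mulr0.
- by rewrite ivl0 mulr0 /rho ge_min lexx.
- by rewrite ivl1 mulr1.
- rewrite ivl1 mulr1 /rho le_min ler_nat leqnSn /= le_max; apply/orP; right.
  by rewrite -natr1 addrK.
- by move=> s; rewrite edge_loopE.
move=> s; rewrite edge_loopE; set u := n.+1%:R * _.
(* Split the polygon of [g] into the part up to [x], the constant edge of the pause, and the
   rest. *)
apply: realization_eqP => v; rewrite !edge_pointE // -(subnKC xn) -addnS -addn1.
rewrite (addnC _ 1%N) !pl_add.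
rewrite (@eq_pl _ _ (fun i => vertex_coord R (f i) v) x _ u); last first.
  by move=> i ix; rewrite fg_le.
rewrite (@eq_pl _ (fun i => vertex_coord R (g (x + (1 + i))%N) v)
  (fun i => vertex_coord R (f (x + i)%N) v) (n - x)%N); last first.
  by move=> i ix; rewrite [in RHS]fg_ge ?addnA ?addn1 ?addSn //; lia.
rewrite {2}/pl big_ord1 addn0 addn1 -(fg_le x) // -(fg_ge x) ?leqnn //.
rewrite subrr mul0r addr0 (addrC (vertex_coord R (f x) v)) addrK.
rewrite (_ : u - x%:R - 1%:R = u - 1 - x%:R); last by lra.
have pl0 w : w <= 0 -> pl (fun i => vertex_coord R (f (x + i)%N) v) (n - x) w =
    vertex_coord R (f x) v.
  by move=> w0; rewrite pl_le0 ?addn0.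
have plx w : x%:R <= w -> pl (fun i => vertex_coord R (f i) v) x w =
    vertex_coord R (f x) v.
  by move=> wx; rewrite pl_ge.
rewrite /rho; have [ux|xu] := leP u x%:R.
  by rewrite min_l ?le_max ?ux // !pl0 //; lra.
have [ux1|xu1] := leP (u - 1) x%:R.
  by rewrite min_r ?(ltW xu) // !pl0 ?plx ?(ltW xu) //; lra.
rewrite min_r; last by lra.
by rewrite !plx //; lra.
Qed.

End EdgeLoops.

(** * Walks in a graph *)

Section Walks.
Variable G : graph.
Implicit Types (x y a b d w : G) (r s t u : seq G).

(** Boolean, so that walks are handled by [path]; the equality case lets a walk wait. *)
Definition reach x y : bool := `[< x = y \/ adj x y >].

Lemma reachxx x : reach x x. Proof. by apply/asboolP; left. Qed.

Lemma reach_sym x y : reach x y -> reach y x.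
Proof.
by move=> /asboolP[->|/adj_sym xy]; apply/asboolP; [left|right].
Qed.

Lemma path_nseq n x s : path reach x (nseq n x ++ s) = path reach x s.
Proof. by elim: n => //= n ->; rewrite reachxx. Qed.

Lemma last_nseq n x : last x (nseq n x) = x.
Proof. by elim: n. Qed.

Section Equivalence.
Variable m : nat.

(* A walk from x is the list of the vertices visited after x. *)
Definition walk_pause x s t :=
  exists s1 s2, s = s1 ++ s2 /\ t = s1 ++ last x s1 :: s2.

(** As [u] and [u'] have the same length, at most [m], and end at the same vertex, the walks differ
    only strictly inside a window of length [m], as in [jump]. *)
Definition walk_hop x s t := exists s1 u u' s2,
  [/\ s = s1 ++ u ++ s2, t = s1 ++ u' ++ s2, size u = size u', (size u <= m)%N
    & last x (s1 ++ u) = last x (s1 ++ u')].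

Definition walk_step x s t :=
  [/\ path reach x s, path reach x t, last x s = last x t
    & walk_pause x s t \/ walk_hop x s t].

Definition walk_equiv x := clos_refl_sym_trans _ (walk_step x).

Lemma walk_equiv_last x s t : walk_equiv x s t -> last x s = last x t.
Proof. by elim=> [{}s {}t []| | |? ? ? _ -> _ ->] //. Qed.

Lemma walk_equiv_path x s t :
  walk_equiv x s t -> path reach x s = path reach x t.
Proof. by elim=> [{}s {}t [-> ->]| | |? ? ? _ -> _ ->] //. Qed.

Lemma walk_equiv_catl x r s t : path reach x r ->
  walk_equiv (last x r) s t -> walk_equiv x (r ++ s) (r ++ t).
Proof.
move=> xr; elim=> [{}s {}t [xs xt st]|?|? ? _|? ? ? _ rs _ st].
- move=> step; apply: rst_step; split; rewrite ?cat_path ?xr ?last_cat //.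
  case: step => [[s1 [s2 [-> ->]]]|[s1 [u [u' [s2 [-> -> uu um ul]]]]]].
    by left; exists (r ++ s1), s2; rewrite -!catA last_cat.
  right; exists (r ++ s1), u, u', s2.
  by rewrite -!catA uu -uu; split; rewrite // !(last_cat x r).
- exact: rst_refl.
- exact: rst_sym.
- exact: rst_trans rs st.
Qed.

Lemma walk_equiv_catr x r s t : path reach (last x s) r ->
  walk_equiv x s t -> walk_equiv x (s ++ r) (t ++ r).
Proof.
move=> sr st; elim: st sr => [{}s {}t [xs xt st]|?|? ? st IH|? ? ? st IH1 _ IH2].
- move=> step sr; apply: rst_step; split.
  + by rewrite cat_path xs.
  + by rewrite cat_path xt -st.
  + by rewrite !last_cat st.
  case: step => [[s1 [s2 [-> ->]]]|[s1 [u [u' [s2 [-> -> uu um ul]]]]]].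
    by left; exists s1, (s2 ++ r); rewrite -!catA.
  by right; exists s1, u, u', (s2 ++ r); rewrite -!catA.
- by move=> _; exact: rst_refl.
- by move=> sr; apply: rst_sym; apply: IH; rewrite (walk_equiv_last st).
- move=> sr; apply: rst_trans (IH1 sr) (IH2 _).
  by rewrite -(walk_equiv_last st).
Qed.

Lemma walk_equiv_nseq x n s : path reach x s ->
  walk_equiv x (nseq n x ++ s) s.
Proof.
move=> xs; elim: n => [|n IH]; first exact: rst_refl.
apply: rst_trans IH; apply: rst_sym; apply: rst_step; split.
- by rewrite path_nseq.
- by rewrite path_nseq.
- by rewrite !last_cat !last_nseq.
- by left; exists [::], (nseq n x ++ s).
Qed.

Lemma walk_equiv_hop x s t : path reach x s -> path reach x t ->
  size s = size t -> (size s <= m)%N -> last x s = last x t ->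
  walk_equiv x s t.
Proof.
move=> xs xt st sm lst; apply: rst_step; split=> //.
by right; exists [::], s, t, [::]; rewrite !cats0.
Qed.

End Equivalence.

(** Since steps may stay in place, a point of the ball is reached in exactly [k] steps. With exact
    lengths, two such walks through a centre form a hop of length [2 * k]. *)
Lemma knbhd_walk_from k w b : knbhd k w b ->
  exists s, [/\ size s = k, path reach w s & last w s = b].
Proof.
elim: k b => [|k IH] b /= => [->|[y /IH[s [sk ws wy]] yb]]; first by exists [::].
exists (rcons s b); split; rewrite ?size_rcons ?sk ?last_rcons //.
rewrite rcons_path ws wy; apply/asboolP.
by case: yb => [->|]; [left|right].
Qed.

Lemma knbhd_walk_to k w b : knbhd k w b ->
  exists s, [/\ size s = k, path reach b s & last b s = w].
Proof.
elim: k b => [|k IH] b /= => [->|[y /IH[s [sk ys yw]] yb]]; first by exists [::].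
exists (y :: s); split; rewrite /= ?sk ?ys ?andbT //; apply/reach_sym/asboolP.
by case: yb => [->|]; [left|right].
Qed.

Lemma knbhd_reach k a b : (0 < k)%N -> reach a b -> knbhd k a b.
Proof.
elim: k => // -[_ _|k IH _] ab.
  by rewrite knbhd1; case/asboolP: ab => [->|]; [left|right].
by exists b; [exact: IH|left].
Qed.

Section Links.
Variable k : nat.
Local Notation m := (2 * k)%N.

(** One chosen walk of length exactly [2 * k] for each pair; the default [[::]] occurs only when
    there is no such walk or [k] is 0. *)
Definition link a b : seq G :=
  xget [::] [set s | [/\ size s = m, path reach a s & last a s = b]].

Lemma linkP w a b : knbhd k w a -> knbhd k w b ->
  [/\ size (link a b) = m, path reach a (link a b) & last a (link a b) = b].
Proof.
move=> /knbhd_walk_to[s [sk as_ sw]] /knbhd_walk_from[t [tk wt tb]].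
rewrite /link; case: xgetP => // /(_ (s ++ t)) []; split.
- by rewrite size_cat sk tk; lia.
- by rewrite cat_path as_ sw.
- by rewrite last_cat sw.
Qed.

(** One hop turns the link into waiting at [a] for [2 * k] units, and the pauses are then
    removed. *)
Lemma link_refl a : walk_equiv m a (link a a) [::].
Proof.
have [sz pa la] := linkP (knbhd_refl k a) (knbhd_refl k a).
apply: rst_trans (walk_equiv_nseq m m (s := [::]) _) => //.
by apply: walk_equiv_hop; rewrite ?path_nseq ?size_cat ?size_nseq ?cats0
  ?last_nseq ?addn0 ?sz ?la // -[nseq _ _]cats0 path_nseq.
Qed.

(** One hop turns the link into waiting at [a] for [2 * k - 1] units followed by the step to [b]. *)
Lemma link_edge a b : (0 < k)%N -> reach a b -> walk_equiv m a (link a b) [:: b].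
Proof.
move=> k0 ab.
have [sz pa la] := linkP (knbhd_refl k a) (knbhd_reach k0 ab).
have pb : path reach a [:: b] by rewrite /= ab.
apply: rst_trans (walk_equiv_nseq m m.-1 pb).
apply: walk_equiv_hop; rewrite ?path_nseq ?last_cat ?size_cat ?size_nseq ?sz //.
by rewrite /=; lia.
Qed.

(* Through a common centre w, the walk a -> w -> b -> w -> d hops over b. *)
Lemma link_triangle w a b d : knbhd k w a -> knbhd k w b -> knbhd k w d ->
  walk_equiv m a (link a b ++ link b d) (link a d).
Proof.
move=> wa wb wd.
have [ab_sz ab_p ab_l] := linkP wa wb; have [bd_sz bd_p bd_l] := linkP wb wd.
have [ad_sz ad_p ad_l] := linkP wa wd.
have [a_w [aw_sz aw_p aw_l]] := knbhd_walk_to wa.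
have [w_b [wb_sz wb_p wb_l]] := knbhd_walk_from wb.
have [b_w [bw_sz bw_p bw_l]] := knbhd_walk_to wb.
have [w_d [wd_sz wd_p wd_l]] := knbhd_walk_from wd.
have hop_ab : walk_equiv m a (link a b) (a_w ++ w_b).
  apply: walk_equiv_hop => //.
  - by rewrite cat_path aw_p aw_l.
  - by rewrite ab_sz size_cat aw_sz wb_sz; lia.
  - by rewrite ab_sz.
  - by rewrite ab_l last_cat aw_l.
have hop_bd : walk_equiv m b (link b d) (b_w ++ w_d).
  apply: walk_equiv_hop => //.
  - by rewrite cat_path bw_p bw_l.
  - by rewrite bd_sz size_cat bw_sz wd_sz; lia.
  - by rewrite bd_sz.
  - by rewrite bd_l last_cat bw_l.
have hop_ww : walk_equiv m w (w_b ++ b_w) (nseq m w ++ [::]).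
  apply: walk_equiv_hop.
  - by rewrite cat_path wb_p wb_l.
  - by rewrite path_nseq.
  - by rewrite size_cat wb_sz bw_sz cats0 size_nseq; lia.
  - by rewrite size_cat wb_sz bw_sz; lia.
  - by rewrite cats0 last_cat wb_l bw_l last_nseq.
apply: (@rst_trans _ _ _ (link a b ++ b_w ++ w_d)).
  by apply: walk_equiv_catl; rewrite ?ab_l.
apply: (@rst_trans _ _ _ (a_w ++ (w_b ++ b_w) ++ w_d)).
  rewrite (_ : a_w ++ _ = (a_w ++ w_b) ++ b_w ++ w_d); last by rewrite !catA.
  apply: walk_equiv_catr hop_ab.
  by rewrite ab_l cat_path bw_p bw_l.
apply: (@rst_trans _ _ _ (a_w ++ w_d)).
  apply: walk_equiv_catl; rewrite ?aw_l //.
  apply: (@rst_trans _ _ _ ((nseq m w ++ [::]) ++ w_d)).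
    by apply: walk_equiv_catr hop_ww; rewrite last_cat wb_l bw_l.
  by rewrite cats0; exact: walk_equiv_nseq.
apply: walk_equiv_hop => //.
- by rewrite cat_path aw_p aw_l.
- by rewrite ad_sz size_cat aw_sz wd_sz; lia.
- by rewrite size_cat aw_sz wd_sz; lia.
- by rewrite ad_l last_cat aw_l.
Qed.

Fixpoint links (f : nat -> G) n : seq G :=
  if n is n'.+1 then links f n' ++ link (f n') (f n'.+1) else [::].

Definition linked (f : nat -> G) n :=
  forall i, (i < n)%N -> exists w, knbhd k w (f i) /\ knbhd k w (f i.+1).

Lemma linkedW f n : linked f n.+1 -> linked f n.
Proof. by move=> fn i ltin; exact/fn/leqW. Qed.

Lemma links_path f n : linked f n ->
  path reach (f 0%N) (links f n) /\ last (f 0%N) (links f n) = f n.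
Proof.
elim: n => [//|n IH] fn /=; have [pn ln] := IH (linkedW fn).
have [w [wa wb]] := fn n (leqnn _); have [_ pa la] := linkP wa wb.
by rewrite cat_path pn last_cat ln pa la.
Qed.

(** The links from [f i] to [g i] are the rungs of a ladder. The four corners of each square lie in
    one ball, so two triangles fill the square. *)
Lemma links_ladder f g n : f 0%N = g 0%N -> f n = g n ->
  (forall i, (i < n)%N -> exists w, [/\ knbhd k w (f i), knbhd k w (f i.+1),
    knbhd k w (g i) & knbhd k w (g i.+1)]) ->
  walk_equiv m (f 0%N) (links f n) (links g n).
Proof.
move=> fg0 fgn fg.
have lf : linked f n by move=> i /fg[w []]; exists w.
have lg : linked g n by move=> i /fg[w []]; exists w.
(* The induction carries the last rung along; at the end it is trivial because [f n = g n]. *)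
suff H : walk_equiv m (f 0%N) (links f n ++ link (f n) (g n)) (links g n).
  have [pf pl] := links_path lf.
  apply: rst_trans H; rewrite -[links f n in X in clos_refl_sym_trans _ _ X]cats0.
  apply: walk_equiv_catl => //; rewrite pl -fgn.
  by apply: rst_sym; exact: link_refl.
elim: n {fgn} lf lg fg => [|n IH] lf lg fg /=.
  by rewrite -fg0; exact: link_refl.
have [w [wf wf' wg wg']] := fg n (leqnn _).
have {}IH := IH (linkedW lf) (linkedW lg) (fun i ni => fg i (leqW ni)).
have [pf lf'] := links_path (linkedW lf); have [pg lg'] := links_path (linkedW lg).
have [_ p1 l1] := linkP wf wf'; have [_ p2 l2] := linkP wf wg.
have [_ p3 l3] := linkP wg wg'.
(* The diagonal from [f n] to [g n.+1] cuts the square into two triangles. *)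
rewrite -catA; apply: (@rst_trans _ _ _ (links f n ++ link (f n) (g n.+1))).
  by apply: walk_equiv_catl; rewrite ?lf' //; exact: link_triangle wf wf' wg'.
apply: (@rst_trans _ _ _ ((links f n ++ link (f n) (g n)) ++ link (g n) (g n.+1))).
  rewrite -catA; apply: walk_equiv_catl => //; rewrite lf'; apply: rst_sym.
  exact: link_triangle wf wg wg'.
by apply: walk_equiv_catr IH; rewrite last_cat lf' l2.
Qed.

(** Where [h] stands still, the link joins a vertex to itself and is trivial; elsewhere both sides
    grow by the same link. This serves to compare subdivisions of different mesh. *)
Lemma links_slow f n (h : nat -> nat) l : linked f n ->
  h 0%N = 0%N -> (forall i, h i.+1 = h i \/ h i.+1 = (h i).+1) ->
  (h l <= n)%N ->
  walk_equiv m (f 0%N) (links (f \o h) l) (links f (h l)).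
Proof.
move=> lf h0 hS; elim: l => [|l IH] hn /=; first by rewrite h0; exact: rst_refl.
have hln : (h l <= n)%N by case: (hS l) hn => ->; lia.
have lhl : linked f (h l) by move=> i ih; apply: lf; lia.
have [pf lf'] := links_path lhl.
have {}IH := IH hln.
have IHl := walk_equiv_last IH; rewrite lf' in IHl.
case: (hS l) => hE.
  rewrite hE; apply: (@rst_trans _ _ _ (links (f \o h) l ++ [::])).
    apply: walk_equiv_catl; last by rewrite IHl; exact: link_refl.
    by rewrite (walk_equiv_path IH).
  by rewrite cats0.
rewrite hE /=; apply: walk_equiv_catr IH; rewrite IHl.
have [|w [wa wb]] := lf (h l); first by rewrite -hE.
by have [] := linkP wa wb.
Qed.

(** By [link_edge] every link along a walk of [G] shrinks to a single step. *)
Lemma links_walk (f : nat -> G) n : (0 < k)%N ->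
  (forall i, reach (f i) (f i.+1)) ->
  walk_equiv m (f 0%N) (links f n) (mkseq (fun i => f i.+1) n).
Proof.
move=> k0 fr.
have lf l : linked f l.
  by move=> i _; exists (f i); split; [exact: knbhd_refl|exact: knbhd_reach].
elim: n => [|n IH] /=; first exact: rst_refl.
have [pf lf'] := links_path (lf n); rewrite mkseqS -cats1.
apply: (@rst_trans _ _ _ (links f n ++ [:: f n.+1])).
  by apply: walk_equiv_catl; rewrite ?lf' //; exact: link_edge.
by apply: walk_equiv_catr IH; rewrite lf' /= fr.
Qed.

End Links.
End Walks.

(** * Graph loops as closed walks *)

Section LoopsOfWalks.
Variables (X : based_graph) (m : nat).
Implicit Types (p q : gloop X) (s t : seq X).

Definition follows p s :=
  plen p = size s /\
  forall i, (i <= size s)%N -> visit p i = nth (base X) (base X :: s) i.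

Lemma visit_reach p i : reach (visit p i) (visit p i.+1).
Proof. exact/asboolP/visit_step. Qed.

Lemma follows_visits p : follows p (mkseq (fun i => visit p i.+1) (plen p)).
Proof.
split; rewrite ?size_mkseq // => -[_|i ip]; first by rewrite visit0.
by rewrite /= nth_mkseq.
Qed.

Lemma follows_inj p q s : follows p s -> follows q s -> p = q.
Proof.
move=> [ps pv] [qs qv]; apply: gloop_eqP => [|i ip]; first by rewrite ps.
by rewrite pv ?qv // -ps.
Qed.

Lemma follows_ex s : path (@reach X) (base X) s -> last (base X) s = base X ->
  exists p, follows p s.
Proof.
move=> ps ls.
have st i : (i < size s)%N -> nth (base X) (base X :: s) i =
    nth (base X) (base X :: s) i.+1 \/
    adj (nth (base X) (base X :: s) i) (nth (base X) (base X :: s) i.+1).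
  by move=> si; apply/asboolP; have /pathP := ps; apply.
have sn : nth (base X) (base X :: s) (size s) = base X by rewrite -last_nth.
exists (mk_gloop st erefl sn); split=> // i si.
exact: visit_mk.
Qed.

(** A pause after [s1] is a [stretch] at time [size s1], and a hop after [s1] is a [jump] whose
    window starts at that time. *)
Lemma walk_step_loops p q s t : walk_step m (base X) s t ->
  follows p s -> follows q t -> stretch p q \/ jump m p q.
Proof.
move=> [_ _ _ st] [ps pv] [qt qv].
case: st => [[s1 [s2 [sE tE]]]|[s1 [u [u' [s2 [sE tE uu um ul]]]]]].
  have szt : size t = (size s).+1 by rewrite sE tE !size_cat /= addnS.
  have s1s : (size s1 <= size s)%N by rewrite sE size_cat leq_addr.
  left; split; first by rewrite ps qt.
  exists (size s1); rewrite ps //; split=> i ix.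
    rewrite pv ?qv; [|by lia..]; rewrite sE tE.
    by rewrite -!cat_cons !nth_cat /= ltnS ix.
  rewrite pv ?qv; [|by lia..]; rewrite sE tE.
  rewrite -!cat_cons !nth_cat /=.
  have -> : (i.+1 < (size s1).+1)%N = false by lia.
  rewrite ltnS.
  have [ix1|xi] := leqP i (size s1); last first.
    by rewrite (_ : i.+1 - _ = (i - (size s1).+1).+1)%N //; lia.
  have -> : i = size s1 by lia.
  by rewrite subnn /= -last_nth.
have szt : size t = size s by rewrite sE tE !size_cat uu.
right; split; first by rewrite ps qt szt.
exists (size s1) => i; rewrite ps => isz ii.
rewrite pv ?qv ?szt //; case: ii => ii.
  by rewrite sE tE -!cat_cons !nth_cat /= ltnS ii.
rewrite sE tE !catA -(cat_cons _ (s1 ++ u)) -(cat_cons _ (s1 ++ u')).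
rewrite [LHS]nth_cat [RHS]nth_cat /= !size_cat -uu ltnS.
(* The one remaining time inside the replaced part is its last, where both walks are at the common
   end vertex. *)
have [iu|//] := leqP i (size s1 + size u); have -> : i = (size s1 + size u)%N by lia.
by rewrite [in RHS]uu -!size_cat -!last_nth.
Qed.

(** Equivalence preserves being a walk and its last vertex, so every intermediate walk in the chain
    is closed and comes from a loop. *)
Lemma walk_equiv_loops p q s t : walk_equiv m (base X) s t ->
  follows p s -> follows q t -> gloop_equiv m p q.
Proof.
move=> st ps qt.
have s_path : path (@reach X) (base X) s.
  case: ps => psz pv; apply/(pathP (base X)) => i si.
  by have := visit_reach p i; rewrite !pv // ltnW.
have s_last : last (base X) s = base X.
  by case: ps => psz pv; rewrite (last_nth (base X)) -pv // -psz visit_end.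
elim: st p q ps qt s_path s_last => {s t}.
- move=> s t st p q ps qt _ _.
  by apply: rst_step; exact: walk_step_loops st ps qt.
- by move=> s p q ps qs _ _; rewrite (follows_inj ps qs); exact: rst_refl.
- move=> s t st IH p q pt qs pat lat; apply: rst_sym; apply: IH => //.
    by rewrite (walk_equiv_path st).
  by rewrite (walk_equiv_last st).
- move=> s r t sr IH1 rt IH2 p q ps qt pas las.
  have par : path (@reach X) (base X) r by rewrite -(walk_equiv_path sr).
  have lar : last (base X) r = base X by rewrite -(walk_equiv_last sr).
  have [w rw] := follows_ex par lar.
  by apply: rst_trans (IH1 p w ps rw pas las) (IH2 w q rw qt par lar).
Qed.

End LoopsOfWalks.

(** * From graph loops to loops in the neighborhood complex *)

Section Comparison.
Variables (R : realType) (k : nat).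
Hypothesis k_gt0 : (0 < k)%N.
Local Notation I := (unit_interval R).
Local Notation m := (2 * k)%N.

Lemma knbhd_leq (G : graph) (j l : nat) (a b : G) :
  (j <= l)%N -> knbhd j a b -> knbhd l a b.
Proof.
elim: l => [|l IH]; first by rewrite leqn0 => /eqP ->.
rewrite leq_eqVlt => /predU1P[-> //|jl] ab.
by exists b; [exact: IH|left].
Qed.

Section Loops.
Variable X : based_graph.
Local Notation K := (ncomplex k X).
Local Notation b := (base X : K).
Implicit Types (p q : gloop X) (f g : nat -> K).

(** A loop moves at most one step per unit of time, also past its end, where [visit] rests at the
    base. *)
Lemma visit_knbhd p (c i : nat) :
  (i <= c + k)%N -> (c <= i + k)%N -> knbhd k (visit p c) (visit p i).
Proof.
have right j : knbhd j (visit p c) (visit p (c + j)).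
  elim: j => [|j IH]; first by rewrite addn0.
  exists (visit p (c + j)) => //; rewrite addnS.
  by case: (visit_step p (c + j)) => [->|]; [left|right].
have left j : knbhd j (visit p c) (visit p (c - j)).
  elim: j => [|j IH]; first by rewrite subn0.
  exists (visit p (c - j)) => //; have [cj|cj] := leqP c j.
    by left; congr visit; lia.
  have -> : (c - j)%N = (c - j.+1).+1 by lia.
  by case: (visit_step p (c - j.+1)) => [->|/adj_sym]; [left|right].
move=> ic ci; have [le_ci|lt_ic] := leqP c i.
  by rewrite -(subnKC le_ci); apply: knbhd_leq (right _); lia.
by rewrite -(subKn (ltnW lt_ic)); apply: knbhd_leq (left _); lia.
Qed.

Lemma visit_edges p N : edge_seq (visit p : nat -> K) N.
Proof.
move=> i _; split; first by rewrite finite_setU; split; exact: finite_set1.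
by exists (visit p i) => v [->|->]; apply: visit_knbhd; lia.
Qed.

Definition geometric_loop p :
    {path I from ncomplex_base R k X to ncomplex_base R k X} :=
  edge_loop (K := K) R (@visit_edges p (plen p)) (visit0 p) (visit_end p).

Lemma geometric_loop_len p N (eN : edge_seq (visit p : nat -> K) N)
    (p0 : visit p 0 = b) (pN : visit p N = b) :
  plen p = N -> geometric_loop p = edge_loop R eN p0 pN.
Proof. by move=> pl; apply/path_eqP => s; rewrite !edge_loopE pl. Qed.

Lemma visit_after p i : (plen p <= i)%N -> visit p i = b.
Proof.
by rewrite leq_eqVlt => /predU1P[<-|/visit_out //]; exact: visit_end.
Qed.

(** The extra time consists of pauses at the base. It makes room for a jump window that extends past
    the end of the loop. *)
Lemma geometric_loop_pad p j (pj : visit p (plen p + j) = b) :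
  loop_homotopic (geometric_loop p)
    (edge_loop R (@visit_edges p (plen p + j)) (visit0 p) pj).
Proof.
elim: j pj => [|j IH] pj.
  rewrite (geometric_loop_len (@visit_edges p (plen p + 0)) (visit0 p) pj).
    exact: loop_homotopic_refl.
  by rewrite addn0.
have pj' : visit p (plen p + j) = b by apply: visit_after; exact: leq_addr.
apply: loop_homotopic_trans (IH pj') _.
move: pj; rewrite addnS => pj.
apply: (@stretch_edge_loop _ _ _ _ _ _ (plen p + j)) => // i ij.
have -> : i = (plen p + j)%N by lia.
by rewrite pj' pj.
Qed.

Lemma stretch_geometric p q : stretch p q ->
  loop_homotopic (geometric_loop p) (geometric_loop q).
Proof.
move=> [lq [x xp [pq_le pq_ge]]].
have qn : visit q (plen p).+1 = b by rewrite -lq visit_end.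
rewrite (geometric_loop_len (@visit_edges q _) (visit0 q) qn lq).
by apply: (@stretch_edge_loop _ _ _ _ _ _ x) => //; exact: pq_ge.
Qed.

(* Waiting at time i0 for m units of time and then joining visit p i0 to
   visit p (i0 + m) by an edge. *)
Definition collapse p i0 i : K :=
  if (i0 <= i < i0 + m)%N then visit p i0 else visit p i.

Lemma collapse_contiguous p i0 i : simplex K
  ([set (visit p i : K); (visit p i.+1 : K)] `|`
   [set collapse p i0 i; collapse p i0 i.+1]).
Proof.
split; first by rewrite !finite_setU; do !split; exact: finite_set1.
(* Times from [i0] to [i0 + m] are within [k] of the midpoint [i0 + k]; outside the window the time
   [i] itself gives a centre. *)
pose c := if (i0 <= i < i0 + m)%N then (i0 + k)%N else i.
exists (visit p c) => v [[->|->]|[->|->]]; rewrite /collapse /c;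
  do ?case: ifP => ?; apply: visit_knbhd; lia.
Qed.

(** Collapsing the window forgets the times at which [p] and [q] may differ, and each padded loop is
    contiguous to its collapse. *)
Lemma jump_geometric p q : jump m p q ->
  loop_homotopic (geometric_loop p) (geometric_loop q).
Proof.
move=> [lpq [i0 pq]].
have visE i : (i <= i0)%N \/ (i0 + m <= i)%N -> visit p i = visit q i.
  have [ip|pi] := leqP i (plen p); first exact: pq.
  by rewrite !visit_after // -?lpq ltnW.
have col_eq i : collapse p i0 i = collapse q i0 i.
  rewrite /collapse; case: ifP => ii; apply: visE; lia.
have col_edges N r : edge_seq (collapse r i0) N.
  move=> i _; apply: simplex_sub (collapse_contiguous r i0 i); exact: subsetUr.
(* Padding by [i0 + m] ensures that the window has closed at the final time, where the collapse must
   be back at the base. *)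
pose N (r : gloop X) := (plen r + (i0 + m))%N.
have col0 r : collapse r i0 0 = b.
  by rewrite /collapse; case: ifP; rewrite ?visit0 // leqn0 => /andP[/eqP ->];
    rewrite visit0.
have colN r : collapse r i0 (N r) = b.
  rewrite /collapse ifF ?visit_after ?leq_addr //.
  by rewrite /N; apply/negbTE; lia.
have visN (r : gloop X) : visit r (N r) = b by rewrite visit_after ?leq_addr.
have to_col r : loop_homotopic (geometric_loop r)
    (edge_loop R (col_edges (N r) r) (col0 r) (colN r)).
  apply: loop_homotopic_trans (geometric_loop_pad (visN r)) _.
  by apply: contiguous_edge_loops => i _; exact: collapse_contiguous.
apply: loop_homotopic_trans (to_col p) _.
apply: loop_homotopic_sym; apply: loop_homotopic_trans (to_col q) _.
rewrite (_ : edge_loop R _ _ (colN q) = edge_loop R _ _ (colN p)).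
  exact: loop_homotopic_refl.
apply/path_eqP => s; rewrite !edge_loopE /N lpq.
by rewrite (_ : collapse q i0 = collapse p i0) //; apply/funext => i.
Qed.

Lemma geometric_loop_equiv p q : gloop_equiv m p q ->
  loop_homotopic (geometric_loop p) (geometric_loop q).
Proof.
elim=> {p q} [p q [|]|p|p q _|p q r _ pq _ qr].
- exact: stretch_geometric.
- exact: jump_geometric.
- exact: loop_homotopic_refl.
- exact: loop_homotopic_sym.
- exact: loop_homotopic_trans pq qr.
Qed.

Lemma geometric_loop_cat p q : loop_homotopic (geometric_loop (gcat p q))
  (concat (geometric_loop p) (geometric_loop q)).
Proof.
pose f := visit (gcat p q) : nat -> K.
have fp i : (i <= plen p)%N -> f i = visit p i.
  by move=> ip; rewrite /f visit_cat ?/gcat_fun ?ip //; lia.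
have fq i : (i <= plen q)%N -> f (plen p + i)%N = visit q i.
  by move=> iq; rewrite /f visit_cat ?gcat_funr ?addKn ?leq_addr ?leq_add2l.
have ef N : edge_seq f N by exact: visit_edges.
have efq : edge_seq (fun i => f (plen p + i)%N) (plen q).
  by move=> i iq; rewrite addnS; exact: (ef _ _ (leqnn _)).
have f0 : f 0 = b by exact: visit0.
have fn : f (plen p) = b by rewrite fp // visit_end.
have fn' : f (plen p + 0)%N = b by rewrite addn0.
have fnm : f (plen p + plen q)%N = b by rewrite fq // visit_end.
have := @concat_edge_loops R K b f (plen p) (plen q) (ef _) (ef _) efq f0 fn fn'
  fnm fnm.
rewrite (eq_edge_loop R (ef (plen p)) (@visit_edges p _) f0 fn (visit0 p)
  (visit_end p) fp).
rewrite (eq_edge_loop R efq (@visit_edges q _) fn' fnm (visit0 q)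
  (visit_end q) fq).
by rewrite -(@geometric_loop_len (gcat p q) (plen p + plen q) (ef _) f0 fnm).
Qed.

End Loops.
End Comparison.

(** * Subdivisions subordinate to open stars *)

Section StarSequences.
Variables (R : realType) (k : nat) (X : based_graph).
Local Notation I := (unit_interval R).
Local Notation K := (ncomplex k X).
Local Notation rK := (realization R K).
Local Notation b := (base X : K).
Local Notation m := (2 * k)%N.
Implicit Types (p q : I -> rK) (w : nat -> K).

Lemma ncomplex_simplex_center (s : set K) : simplex K s ->
  exists c, s `<=` (knbhd k c : set X).
Proof. by case=> _ [c]; exists c. Qed.

(* For l = M the piece of the interval is the endpoint alone. *)
Definition star_seq p (M : nat) w := (0 < M)%N /\
  forall l (s : I), (l <= M)%N -> l%:R <= M%:R * ivl s <= l%:R + 1 ->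
    p s (w l) != 0.

Lemma grid_point (M l : nat) : (0 < M)%N -> (l <= M)%N ->
  exists s : I, M%:R * ivl s = l%:R.
Proof.
move=> M0 lM; exists (clamp (l%:R / M%:R)).
have M0R : (0 < M%:R :> R) by rewrite ltr0n.
rewrite ivl_clamp; last first.
  by rewrite divr_ge0 ?ler0n //= ler_pdivrMr // mul1r ler_nat.
by rewrite mulrC divfK // gt_eqF.
Qed.

(** Consecutive pieces share the parameter [l.+1 / M], so both star centres lie in the support of
    its image. *)
Lemma star_seq_step p M w l : star_seq p M w -> (l < M)%N ->
  exists s : I, M%:R * ivl s = l.+1%:R /\ p s (w l) != 0 /\ p s (w l.+1) != 0.
Proof.
move=> [M0 Mw] lM; have [s sE] := grid_point M0 lM.
exists s; split=> //; split; apply: Mw; rewrite ?(ltnW lM) // sE.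
  by rewrite ler_nat leqnSn /= natr1.
by rewrite lexx lerDl ler01.
Qed.

Lemma star_seq_linked p M w : star_seq p M w -> linked k w M.
Proof.
move=> pw l lM; have [s [_ [wl wl']]] := star_seq_step pw lM.
have [c pc] := ncomplex_simplex_center (coord_simplex (p s)).
by exists c; split; exact: pc.
Qed.

Lemma star_seq_ends p M w : p zero = vertex_point R b ->
  p one = vertex_point R b -> star_seq p M w -> w 0%N = b /\ w M = b.
Proof.
move=> p0 p1 [M0 Mw].
have vertexP v : vertex_point R b v != 0 -> v = b.
  by move=> bv; have : supp (vertex_point R b) v := bv; rewrite support_vertex.
split; apply: vertexP.
  by rewrite -p0; apply: Mw; rewrite // ivl0 mulr0 lexx add0r ler01.
by rewrite -p1; apply: Mw; rewrite // ivl1 mulr1 lexx lerDl ler01.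
Qed.

(** At a parameter shared by consecutive pieces, the four vertices of a square of the ladder lie in
    the support of one point, hence in one ball. *)
Lemma star_seq_ladder p M w w' : p zero = vertex_point R b ->
  p one = vertex_point R b -> star_seq p M w -> star_seq p M w' ->
  walk_equiv m (base X) (links k w M) (links k w' M).
Proof.
move=> p0 p1 pw pw'; have [w0 wM] := star_seq_ends p0 p1 pw.
have [w0' wM'] := star_seq_ends p0 p1 pw'.
rewrite -[base X]w0; apply: links_ladder; rewrite ?w0 ?w0' ?wM ?wM' //.
move=> l lM; have [s [sE [wl wl']]] := star_seq_step pw lM.
have [M0 Mw'] := pw'.
have [c pc] := ncomplex_simplex_center (coord_simplex (p s)).
exists c; split; apply: pc => //=; apply: Mw'; rewrite ?(ltnW lM) // sE.
  by rewrite ler_nat leqnSn /= natr1.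
by rewrite lexx lerDl ler01.
Qed.

Lemma star_seq_refine p M w d : (0 < d)%N -> star_seq p M w ->
  star_seq p (M * d) (fun l => w (l %/ d)%N).
Proof.
move=> d0 [M0 Mw]; split; first by rewrite muln_gt0 M0.
move=> l s lMq /andP[ls sl]; apply: Mw; first by rewrite -(mulnK M d0) leq_div2r.
have d0R : (0 < d%:R :> R) by rewrite ltr0n.
have ld : ((l %/ d * d)%N%:R <= l%:R :> R) by rewrite ler_nat leq_trunc_div.
have dl : (l.+1%:R <= ((l %/ d).+1 * d)%N%:R :> R).
  by rewrite ler_nat ltn_ceil.
rewrite !natrM in ld dl ls sl; rewrite -natr1 in dl.
rewrite natr1; apply/andP; split; rewrite -(ler_pM2r d0R).
  by rewrite [X in _ <= X]mulrAC; exact: le_trans ld ls.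
by rewrite [X in X <= _]mulrAC; exact: le_trans sl dl.
Qed.

Lemma links_refine p M w d : (0 < d)%N -> star_seq p M w ->
  walk_equiv m (w 0%N) (links k (fun l => w (l %/ d)%N) (M * d)) (links k w M).
Proof.
move=> d0 pw.
have := @links_slow _ k w M (fun l => (l %/ d)%N) (M * d) (star_seq_linked pw).
rewrite mulnK // => H; apply: H => //; first exact: div0n.
by move=> i; rewrite divnS //; case: (_ %| _)%N; [right|left].
Qed.

(** Both subdivisions are compared on their common refinement into [M * M'] pieces. *)
Lemma star_seq_indep p M M' w w' : p zero = vertex_point R b ->
  p one = vertex_point R b -> star_seq p M w -> star_seq p M' w' ->
  walk_equiv m (base X) (links k w M) (links k w' M').
Proof.
move=> p0 p1 pw pw'; have [w0 _] := star_seq_ends p0 p1 pw.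
have [w0' _] := star_seq_ends p0 p1 pw'.
have M0 : (0 < M)%N by case: pw.
have M0' : (0 < M')%N by case: pw'.
have r := links_refine M0' pw; have r' := links_refine M0 pw'.
rewrite w0 in r; rewrite w0' in r'.
apply: rst_trans (rst_sym _ _ _ _ r) _; apply: rst_trans r'.
rewrite [X in links _ _ X]mulnC; apply: star_seq_ladder p0 p1 _ _.
  by rewrite mulnC; exact: star_seq_refine.
exact: star_seq_refine.
Qed.

Lemma star_seq_homotopic (p q : {path I from vertex_point R b to vertex_point R b})
    M M' w w' :
  loop_homotopic p q -> star_seq p M w -> star_seq q M' w' ->
  walk_equiv m (base X) (links k w M) (links k w' M').
Proof.
move=> [H [cH H0 H1 Hb]] pw qw'.
have [N [N0 [v vP]]] := star_grid cH.
have near_l (l : nat) (r : R) : l%:R <= r <= l%:R + 1 -> `|r - l%:R| <= 1.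
  by move=> lr; rewrite ler_norml; lra.
have row i (t : I) : (i <= N)%N -> `|N%:R * ivl t - i%:R| <= 1 ->
    star_seq (fun s => H (s, t)) N (v^~ i).
  by move=> iN it; split=> // l s lN ls; apply: vP => //; exact: near_l.
have rows i : (i <= N)%N ->
    walk_equiv m (base X) (links k (v^~ 0%N) N) (links k (v^~ i) N).
  elim: i => [|i IH] iN; first exact: rst_refl.
  apply: rst_trans (IH (ltnW iN)) _.
  (* Rows [i] and [i.+1] are both star sequences for the path at time [i / N], because the stars of
     the grid cover one mesh in each direction. *)
  have [t tE] := grid_point N0 (ltnW iN); have [Hz Ho] := Hb t.
  apply: (star_seq_ladder Hz Ho).
    by apply: (row i t (ltnW iN)); rewrite tE subrr normr0.
  apply: (row i.+1 t iN).
  by rewrite tE -natr1 opprD addrA subrr add0r normrN normr1.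
have p_row : star_seq p N (v^~ 0%N).
  have := row 0%N zero (leq0n _); rewrite ivl0 mulr0 subr0 normr0 => /(_ ler01).
  by rewrite (_ : (fun s => H (s, zero)) = p) //; apply/funext.
have q_row : star_seq q N (v^~ N).
  have := row N one (leqnn _); rewrite ivl1 mulr1 subrr normr0 => /(_ ler01).
  by rewrite (_ : (fun s => H (s, one)) = q) //; apply/funext.
have h1 := star_seq_indep (@path_zero _ _ _ _ p) (@path_one _ _ _ _ p) pw p_row.
have h2 := star_seq_indep (@path_zero _ _ _ _ q) (@path_one _ _ _ _ q) q_row qw'.
exact: rst_trans h1 (rst_trans _ _ _ _ _ (rows N (leqnn _)) h2).
Qed.

End StarSequences.

(** * Injectivity and surjectivity up to homotopy *)

Section Bijectivity.
Variables (R : realType) (k : nat).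
Hypothesis k_gt0 : (0 < k)%N.
Variable X : based_graph.
Local Notation I := (unit_interval R).
Local Notation K := (ncomplex k X).
Local Notation b := (base X : K).
Local Notation m := (2 * k)%N.
Local Notation geo := (geometric_loop R k_gt0).
Implicit Types p q : gloop X.

(* On the l-th of 2n half segments, the nearest vertex has index uphalf l. *)
Lemma geometric_star_seq p : (0 < plen p)%N ->
  star_seq (geo p) (2 * plen p) (fun l => visit p (uphalf l)).
Proof.
move=> p0; split; first by lia.
set n := plen p; move=> l s ln; rewrite natrM -mulrA; set u := n%:R * ivl s.
have un : u <= n%:R by rewrite ler_piMr ?ler0n // ivl_le1.
move=> lu; rewrite edge_loopE -/n -/u.
have lE : (l = odd l + (l./2).*2)%N by rewrite odd_double_half.
have hE : (uphalf l = odd l + l./2)%N by rewrite uphalf_half.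
have lER : (l%:R = (odd l)%:R + 2 * (l./2)%:R :> R).
  by rewrite {1}lE natrD -muln2 natrM mulrC.
move: lu; rewrite lER hE; set i := l./2 in lE hE lER * => /andP[lu ul].
(* The case [n <= i] is [l = 2 * n], where the piece is the endpoint alone. *)
have [iln|nli] := ltnP i n; last first.
  have lo : odd l = false by move: ln; rewrite lE -muln2 -/n; case: (odd l); lia.
  have -> : (odd l + i = n)%N.
    by move: ln; rewrite lE lo -muln2 -/n; lia.
  have nu : n%:R <= u.
    rewrite lo add0r in lu; have : (n%:R <= i%:R :> R) by rewrite ler_nat.
    by lra.
  by rewrite edge_point_ge //; [rewrite /= /vertex_coord eqxx oner_eq0
    |exact: visit_edges].
have iu : i%:R <= u <= i%:R + 1.
  by case: (odd l) lu ul => /= lu ul; apply/andP; split; lra.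
(* The nearer end has weight at least 1/2, and the other term is nonnegative. *)
rewrite (edge_point_segment (visit_edges k_gt0 p (N := n)) iln iu) gt_eqF //.
case: (odd l) lu ul => /= lu ul; rewrite ?add1n ?add0n /vertex_coord eqxx mulr1.
  have := ler0n R (visit p i.+1 == visit p i :> K); nra.
have := ler0n R (visit p i == visit p i.+1 :> K); nra.
Qed.

(** Links along the half segments reduce by [links_slow] to links along the visits of [p], and these
    by [links_walk] to the walk of [p]. *)
Lemma geometric_star_links p : exists M w, star_seq (geo p) M w /\
  walk_equiv m (base X) (links k w M) (mkseq (fun i => visit p i.+1) (plen p)).
Proof.
have [p0|p0] := posnP (plen p).
  (* A loop of length 0 still gets one piece, since [star_seq] requires a positive number. *)
  exists 1%N, (fun=> base X); split.
    split=> // l s _ _; rewrite edge_loopE p0 edge_point_le0 ?mul0r //.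
    by rewrite /= visit0 /vertex_coord eqxx oner_eq0.
  by rewrite p0; exact: link_refl.
exists (2 * plen p)%N, (fun l => visit p (uphalf l)).
split; first exact: geometric_star_seq.
rewrite -(visit0 p).
have step : forall i, reach (visit p i) (visit p i.+1) := visit_reach p.
have vl : linked k (visit p) (plen p).
  move=> i _; exists (visit p i).
  by split; [exact: knbhd_refl|exact: knbhd_reach].
apply: rst_trans (links_walk (plen p) k_gt0 step).
have := @links_slow _ k (visit p) (plen p) uphalf (2 * plen p) vl.
rewrite mul2n uphalf_double; apply=> //.
by move=> i; rewrite /= uphalf_half; case: (odd i); [left|right].
Qed.

Lemma geometric_loop_injective p q :
  loop_homotopic (geo p) (geo q) -> gloop_equiv m p q.
Proof.
move=> pq; have [M [w [pw wp]]] := geometric_star_links p.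
have [M' [w' [qw' wq']]] := geometric_star_links q.
apply: walk_equiv_loops (follows_visits p) (follows_visits q).
apply: rst_trans (rst_sym _ _ _ _ wp) _; apply: rst_trans wq'.
exact: star_seq_homotopic pq pw qw'.
Qed.

Lemma size_links (f : nat -> X) n : linked k f n -> size (links k f n) = (m * n)%N.
Proof.
elim: n => [|n IH] fn /=; first by rewrite muln0.
have [c [ca cb]] := fn n (leqnn _); have [sz _ _] := linkP ca cb.
by rewrite size_cat IH ?sz; [lia|exact: linkedW].
Qed.

Lemma nth_links (f : nat -> X) n i : linked k f n -> (i <= n)%N ->
  nth (f 0%N) (f 0%N :: links k f n) (m * i) = f i.
Proof.
elim: n => [|n IH] fn; first by rewrite leqn0 => /eqP ->; rewrite muln0.
rewrite leq_eqVlt => /predU1P[->|iltn].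
  have [_ ll] := links_path fn.
  by rewrite -[RHS]ll -(size_links fn) -last_nth.
rewrite [links _ _ _]/= -cat_cons nth_cat /= size_links; last exact: linkedW.
by rewrite ltnS leq_mul2l -ltnS iltn orbT; apply: IH => //; exact: linkedW.
Qed.

Lemma geometric_loop_surjective
    (l : {path I from ncomplex_base R k X to ncomplex_base R k X}) :
  exists p, loop_homotopic l (geo p).
Proof.
(* The loop is viewed as a homotopy constant in time, so that row 0 of a star grid subdivides it. *)
have cl : continuous (fun st : I * I => l st.1).
  by apply: (cts_comp (g := l)); [cts|exact: cts_fun].
have [N [N0 [v0 v0P]]] := star_grid cl; pose v i := v0 i 0%N.
have vP i (s : I) : (i <= N)%N -> `|N%:R * ivl s - i%:R| <= 1 -> l s (v i) != 0.
  move=> iN si; have /= := v0P i 0%N s zero iN (leq0n N) si.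
  by apply; rewrite ivl0 mulr0 subr0 normr0.
have near_l (j : nat) (r : R) : j%:R <= r <= j%:R + 1 -> `|r - j%:R| <= 1.
  by move=> jr; rewrite ler_norml; lra.
have sv : star_seq l N v by split=> // i s iN si; apply: vP => //; exact: near_l.
have [v0b vNb] := star_seq_ends (@path_zero _ _ _ _ l) (@path_one _ _ _ _ l) sv.
have vl : linked k v N := star_seq_linked sv.
have [pl ll] := links_path vl; rewrite v0b in pl ll; rewrite vNb in ll.
have [p [psz pv]] := follows_ex pl ll.
have m0 : (0 < m)%N by lia.
have vis i : (i <= N)%N -> visit p (m * i) = v i.
  by move=> iN; rewrite pv ?size_links ?leq_mul2l ?iN ?orbT // -v0b nth_links.
have pN : plen p = (N * m)%N by rewrite psz size_links // mulnC.
(* [w] holds each star centre for [m] units, which gives it the length of [p]. *)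
exists p; pose w j := v (j %/ m)%N; pose M := (N * m)%N.
have sw : star_seq l M w by exact: star_seq_refine.
(* The linear homotopy needs both ends of the edge in the support of [l s]. At the end of a block
   [w j.+1] is already the next centre; the margin of one mesh in [vP] covers this. *)
have sw1 j (s : I) : (j < M)%N -> j%:R <= M%:R * ivl s <= j%:R + 1 ->
    l s (w j.+1) != 0.
  move=> jM /andP[js sj]; apply: vP.
    by rewrite -(mulnK N m0) leq_div2r.
  have m0R : (0 < m%:R :> R) by rewrite ltr0n.
  have le1 : ((j.+1 %/ m * m)%N%:R <= j.+1%:R :> R).
    by rewrite ler_nat leq_trunc_div.
  have le2 : (j.+2%:R <= ((j.+1 %/ m).+1 * m)%N%:R :> R).
    by rewrite ler_nat ltn_ceil.
  have m1R : (1 <= m%:R :> R) by rewrite ler1n.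
  rewrite !natrM -!natr1 in le1 le2 js sj.
  rewrite -(ler_pM2r m0R) mul1r -[X in _ * X <= _](ger0_norm (ltW m0R)) -normrM.
  rewrite mulrBl mulrAC ler_norml; apply/andP; split; nra.
have w0 : w 0%N = b by rewrite /w div0n.
have wM : w M = b by rewrite /w mulnK.
have w_edges : edge_seq w M.
  move=> j jM; have [s [_ [wj wj1]]] := star_seq_step sw jM.
  by apply: simplex_sub (coord_simplex (l s)) => x [->|->].
apply: (@loop_homotopic_trans _ _ _ _ (edge_loop R w_edges w0 wM)).
  apply: linear_homotopy => s; apply: simplex_sub (coord_simplex (l s)).
  have M0 : (0 < M)%N by rewrite muln_gt0 N0.
  have [j jM js] := in_segment_mul s M0.
  rewrite edge_loopE => x [//|/(support_edge_point w_edges jM js)[->|->]].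
    by case: sw => _; apply; rewrite // ltnW.
  exact: sw1.
have pM : visit p M = b by rewrite /M -pN visit_end.
rewrite (geometric_loop_len R k_gt0 (visit_edges k_gt0 p (N := M))
  (visit0 p) pM pN).
apply: contiguous_edge_loops => j jM; split.
  by rewrite !finite_setU; do !split; exact: finite_set1.
pose i := (j %/ m)%N.
have iN : (i < N)%N by rewrite ltn_divLR.
have wj : w j = visit p (m * i) by rewrite vis // ltnW.
have jE := divn_eq j m; rewrite -/i in jE.
have jm : (j %% m < m)%N by rewrite ltn_mod.
have wj1 : w j.+1 = visit p (m * i) \/ w j.+1 = visit p (m * i.+1).
  rewrite /w divnS // -/i; case: (_ %| _)%N; [right|left].
    by rewrite add1n vis.
  by rewrite add0n vis // ltnW.
move: (w j) (w j.+1) wj wj1 => _ wb -> wbE.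
(* The middle of the [i]-th link is within [k] units of all four times involved, which lie between
   [m * i] and [m * i.+1]. *)
exists (visit p (m * i + k)) => x [[->|->]|[->|->]];
  [|case: wbE => ->| |]; apply: visit_knbhd; lia.
Qed.

End Bijectivity.

(** * Naturality in the based graph *)

Section Naturality.
Variable R : realType.

(** The induced map is affine on each edge, so it is determined there by the images of the two end
    vertices. *)
Lemma realization_map_edge_point (K L : simplicial_complex)
    (F : simplicial_map K L) (f : nat -> K) n (u : R) :
  edge_seq f n -> edge_seq (F \o f) n ->
  realization_map F (edge_point f n u) = edge_point (F \o f) n u.
Proof.
move=> ef eFf; have [u0|u0] := leP u 0.
  by rewrite !edge_point_le0 // realization_map_vertex.
have [un|un] := leP n%:R u.
  by rewrite !edge_point_ge // realization_map_vertex.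
have n0 : (0 < n)%N.
  by case: n un {ef eFf} => // u0'; have := lt_trans u0 u0'; rewrite ltxx.
have [|l ln lu] := @in_segment R n u n0; first by rewrite (ltW u0) ltW.
apply: realization_eqP => y /=; rewrite (edge_point_segment eFf ln lu).
pose s := [set f l; f l.+1].
have fs : finite_set s by rewrite finite_setU; split; exact: finite_set1.
have fin : finite_set (s `&` F @^-1` [set y]) by exact: finite_setIl.
have vertexE x : s x -> vertex_coord R (F x) y =
    \sum_(v \in s `&` F @^-1` [set y]) vertex_coord R x v.
  move=> sx; have := realization_map_vertex R F x.
  move=> /(congr1 (fun z : realization R L => z y)) /= <-.
  rewrite (@push_coordE _ _ _ _ _ s) // => v /= xv.
  by have : supp (vertex_point R x) v := xv; rewrite support_vertex => ->.
rewrite (@push_coordE _ _ _ _ _ s) //; last exact: support_edge_point lu.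
rewrite /= !vertexE; [|by right|by left].
rewrite !fsbig_finite // !mulr_sumr -big_split /=; apply: eq_bigr => v _.
exact: edge_point_segment.
Qed.

Variables (k : nat) (X Y : based_graph) (f : based_map X Y).
Hypothesis k_gt0 : (0 < k)%N.

(** Both loops are the polygon through the vertices [f (visit p i)] at the same speed, so they are
    equal on the nose. *)
Lemma geometric_loop_push (p : gloop X) :
  push_loop (@realization_map_continuous R _ _ (ncomplex_map k f))
    (ncomplex_map_base R k f) (geometric_loop R k_gt0 p) =
  geometric_loop R k_gt0 (gpush f p).
Proof.
apply/path_eqP => s; rewrite [RHS]edge_loopE.
have -> : push_loop (@realization_map_continuous R _ _ (ncomplex_map k f))
    (ncomplex_map_base R k f) (geometric_loop R k_gt0 p) s =
  realization_map (ncomplex_map k f) (geometric_loop R k_gt0 p s) by [].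
rewrite edge_loopE realization_map_edge_point //; first exact: visit_edges.
exact: (visit_edges k_gt0 (gpush f p)).
Qed.

End Naturality.

(** * The comparison isomorphism of groups *)

Section Isomorphism.
Variables (R : realType) (k : nat) (k_gt0 : (0 < k)%N) (X : based_graph).
Local Notation pi := (pi1m X (double_ge2 k_gt0)).
Local Notation class := (gloop_class (double_ge2 k_gt0)).

Definition comparison (a : pi) : pi1 R (ncomplex_base R k X) :=
  loop_class (geometric_loop R k_gt0 (repr a)).

Lemma comparisonE (p : gloop X) :
  comparison (class p) = loop_class (geometric_loop R k_gt0 p).
Proof. by apply/loop_classP/geometric_loop_equiv/repr_gloop_class. Qed.

Lemma comparisonM : {morph comparison : a c / (a * c)%g >-> (a * c)%g}.
Proof.
move=> a c; have [p ->] := gloop_class_surj a; have [q ->] := gloop_class_surj c.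
rewrite [(_ * _)%g in LHS]pi1m_mulE !comparisonE.
rewrite [RHS]pi1_mulE; apply/loop_classP; exact: geometric_loop_cat.
Qed.

HB.instance Definition _ := isMultiplicative.Build _ _ comparison comparisonM.

Lemma comparison_bijective : bijective comparison.
Proof.
have inj : injective comparison.
  move=> a c; have [p ->] := gloop_class_surj a.
  have [q ->] := gloop_class_surj c; rewrite !comparisonE => /loop_classP pq.
  by apply/gloop_classP; exact: geometric_loop_injective pq.
have surj c : exists a, comparison a = c.
  have [l ->] := loop_class_surj c.
  have [p lp] := geometric_loop_surjective k_gt0 l.
  by exists (class p); rewrite comparisonE; apply/loop_classP/loop_homotopic_sym.
have [g gK] := choice surj.
by exists g => // a; apply: inj; rewrite gK.
Qed.

End Isomorphism.

Theorem theorem1p5 (R : realType) (k : nat) (k_gt0 : (0 < k)%N) :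
  exists phi : forall X : based_graph,
      {multiplicative pi1m X (double_ge2 k_gt0) -> pi1 R (ncomplex_base R k X)},
    (forall X : based_graph, bijective (phi X)) /\
    (forall (X Y : based_graph) (f : based_map X Y)
        (a : pi1m X (double_ge2 k_gt0)),
      phi Y (pi1m_map f a)
      = pi1_ncomplex_map f (phi X a)).
Proof.
exists (fun X => @comparison R k k_gt0 X); split=> [X|X Y f a].
  exact: comparison_bijective.
have [p ->] := gloop_class_surj a.
rewrite pi1m_mapE /= !comparisonE [RHS]pi1_mapE.
by rewrite geometric_loop_push.
Qed.
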